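(* Let $p$ be an odd prime and $n>0$. Let $D_{+}$, $D_{-}$ and $D_{0}$ be three oriented $p^{n}$-periodic link diagrams which are identical except at the crossings of one orbit (of $p^{n}$ crossings) of the rotation: in $D_{+}$ all crossings of this orbit are positive, in $D_{-}$ all crossings of this orbit are negative, and in $D_{0}$ every crossing of this orbit is replaced by its orientation-preserving resolution. Then the difference Jones polynomials have the following properties. (1) The following equality holds in $\mathbb{Z}[q,q^{-1}]$: $$q^{-2p^{n}}\,\mathrm{DJ}_{n,0}(D_{+})-q^{2p^{n}}\,\mathrm{DJ}_{n,0}(D_{-})=\left(q^{-p^{n}}-q^{p^{n}}\right)\mathrm{DJ}_{n,0}(D_{0}).$$ (2) For every $0\le s\le n$ the following congruence holds in $\mathbb{Z}[q,q^{-1}]$: $$q^{-2p^{n}}\,\mathrm{DJ}_{n,n-s}(D_{+})-q^{2p^{n}}\,\mathrm{DJ}_{n,n-s}(D_{-})\equiv\left(q^{-p^{n}}-q^{p^{n}}\right)\mathrm{DJ}_{n,n-s}(D_{0})\pmod{q^{p^{s}}-q^{-p^{s}}}.$$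
   Context: Periodic diagrams. An $N$-periodic link diagram $D$ is an oriented planar link diagram which is invariant (including crossing information and orientation) under the rotation of the plane by $2\pi/N$ about a point $F$ not lying on $D$ (the projection of the rotation axis). Thus $\mathbb{Z}/N$ acts on $D$, and every crossing has an orbit of exactly $N$ crossings. Let $n_{+}(D)$, $n_{-}(D)$ be the numbers of positive and negative crossings. Khovanov complex. A Kauffman state $s$ of $D$ is a choice of $0$- or $1$-smoothing at each crossing (identified with the resulting crossingless diagram); the orientation-preserving resolution is the $0$-smoothing at a positive crossing and the $1$-smoothing at a negative crossing. Let $r(s)$ be the number of $1$-smoothings. Let $A=\mathbb{Q}v_{+}\oplus\mathbb{Q}v_{-}$, $\deg v_{\pm}=\pm1$, with multiplication $v_+v_+=v_+$, $v_+v_-=v_-v_+=v_-$, $v_-v_-=0$ and comultiplication $v_+\mapsto v_+\otimes v_-+v_-\otimes v_+$, $v_-\mapsto v_-\otimes v_-$. The Khovanov complex $\mathrm{CKh}^{i,j}(D;\mathbb{Q})$ is the direct sum, over states $s$ with $r(s)=i+n_{-}(D)$, of the part of $A^{\otimes\{\text{circles of }s\}}\otimes\Lambda^{r(s)}\mathbb{Q}^{\{1\text{-smoothed crossings of }s\}}$ of degree $j-r(s)-n_{+}(D)+2n_{-}(D)$ (the exterior power in degree $0$); the differential is the sum, over changes of one $0$-smoothing at a crossing $c$ to a $1$-smoothing, of the merge (multiplication) or split (comultiplication) map tensored with exterior multiplication by $c$. Its cohomology is $\mathrm{Kh}^{i,j}(D;\mathbb{Q})$. The rotation permutes crossings, states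 and circles, so $\mathbb{Z}/N$ acts and $\mathrm{CKh}(D;\mathbb{Q})$ is a complex of graded $\mathbb{Q}[\mathbb{Z}/N]$-modules. Equivariant homology. For $d\mid N$ let $\xi_d$ be a primitive $d$-th root of unity, and let a generator of $\mathbb{Z}/N$ act on the cyclotomic field $\mathbb{Q}[\xi_d]$ by multiplication by $\xi_d$. Put $$\mathrm{Kh}^{*,*,d}_{\mathbb{Z}/N}(D;\mathbb{Q})=H^{*,*}\left(\mathrm{Hom}_{\mathbb{Q}[\mathbb{Z}/N]}(\mathbb{Q}[\xi_d],\mathrm{CKh}(D;\mathbb{Q}))\right),$$ a $\mathbb{Q}[\xi_d]$-vector space, and define the equivariant Jones polynomial $$\mathrm{J}_{N,d}(D)(q)=\sum_{i,j}(-1)^{i}q^{j}\dim_{\mathbb{Q}[\xi_d]}\mathrm{Kh}^{i,j,d}_{\mathbb{Z}/N}(D;\mathbb{Q}).$$ Difference Jones polynomials. For a $p^{n}$-periodic diagram $D$ and $0\le s\le n$ put $\mathrm{DJ}_{n,s}(D)=\mathrm{J}_{p^{n},p^{s}}(D)-\mathrm{J}_{p^{n},p^{s+1}}(D)$, with the convention $\mathrm{J}_{p^{n},p^{n+1}}=0$. *)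

(* Defs.v *)
From HB Require Import structures.
From mathcomp Require Import all_boot all_order all_algebra all_fingroup all_field.

Set Implicit Arguments.
Unset Strict Implicit.
Unset Printing Implicit Defensive.

Import Order.TTheory GRing.Theory Num.Theory.
Local Open Scope ring_scope.

(* Classes of the equivalence relation generated by e. *)
Definition classes (T : finType) (e : rel T) : {set {set T}} :=
  [set [set y | connect (fun a b => e a b || e b a) x y] | x : T].

(** * Plane diagrams *)

(* An oriented link diagram is a plane graph whose vertices are crossings and
   marked points of degree 2; marked points only subdivide arcs (and allow
   components without crossings).  Rotate a crossing c so that its two strands
   run upwards:

        (c,false) out   (c,true) out          NW   NE
                      X                          X
        (c,false) in    (c,true) in           SW   SE

   A "strand" names one incoming and one outgoing end: (c,b) is the left
   (b = false) or right (b = true) end of the crossing c, and a marked point has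
   one incoming and one outgoing end.  The permutation [next] sends an outgoing
   end to the incoming end at the other extremity of its arc.  Thus arcs are also
   indexed by strands: the arc a runs from the outgoing end a to the incoming
   end [next a].  [rot_site] and [rot_mark] give the action of the rotation.

   A site is either a crossing or the oriented resolution of a crossing, i.e.
   two parallel strands (c,false), (c,true) which amount to two marked points.
   So a diagram and its oriented resolution at some crossings share their
   [shadow], and differ only by the kind of these sites. *)
Record shadow := Shadow {
  site : finType;
  mark : finType;
  next : {perm site * bool + mark};
  rot_site : {perm site};
  rot_mark : {perm mark} }.

Definition strand (G : shadow) : finType := (site G * bool + mark G)%type.

(* Positive: the strand from SW to NE is the overpass. *)
Inductive site_kind := Positive | Negative | Smoothed.

Definition diagram (G : shadow) := site G -> site_kind.

Definition is_positive k := if k is Positive then true else false.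
Definition is_negative k := if k is Negative then true else false.
Definition is_crossing k := is_positive k || is_negative k.

Section Diagram.
Variables (G : shadow) (D : diagram G).

Definition crossings : {set site G} := [set c | is_crossing (D c)].
Definition npos : nat := #|[set c | is_positive (D c)]|.
Definition nneg : nat := #|[set c | is_negative (D c)]|.

Definition prev : {perm strand G} := (next G)^-1%g.

Definition opposite (v : strand G) : strand G :=
  match v with inl (c, b) => inl (c, ~~ b) | inr m => inr m end.

Definition on_crossing (v : strand G) : bool :=
  match v with inl (c, _) => is_crossing (D c) | inr _ => false end.

Definition rot_strand (v : strand G) : strand G :=
  match v with inl (c, b) => inl (rot_site G c, b) | inr m => inr (rot_mark G m) end.

(* The connected components of the plane graph. *)
Definition adjacent (a b : strand G) : bool :=
  (b == next G a) || (on_crossing a && (b == opposite a)).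

Definition component (a : strand G) : {set strand G} :=
  [set b | connect (fun a b => adjacent a b || adjacent b a) a b].

(* A dart is an arc with a direction of travel: true is that of the orientation.
   [face] follows the boundary of the region on the left of the traveller. *)
Definition dart : finType := (strand G * bool)%type.

Definition face (z : dart) : dart :=
  let: (a, forward) := z in
  if forward then
    let v := next G a in
    match v with
    | inl (c, true) =>
        if is_crossing (D c) then (prev (inl (c, false)), false) else (v, true)
    | _ => (v, true)
    end
  else
    match a with
    | inl (c, false) =>
        if is_crossing (D c) then (inl (c, true), true) else (prev a, false)
    | _ => (prev a, false)
    end.

(* Euler's formula V - E + F = 2 C, i.e. all components have genus 0; since
   crossings have degree 4 and other vertices have degree 2, V - E is minus the
   number of crossings. *)
Definition planar : Prop :=
  (#|classes (frel face)| = #|crossings| + 2 * #|classes adjacent|)%N.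

Definition rot_dart (z : dart) : dart := (rot_strand z.1, z.2).

(* [rot_strand] is induced by the rotation by 2 pi / N about a point F outside the
   diagram.  The rotation is free on the diagram.  A component which meets one
   of its images under a nontrivial power of the rotation surrounds F, and the
   rotation turns the boundary of the face of this component that contains F
   counterclockwise by one N-th of its length; other components are permuted
   freely. *)
Record periodic (N : nat) : Prop := Periodic {
  periodic_planar : planar;
  periodic_next : forall a, next G (rot_strand a) = rot_strand (next G a);
  periodic_kind : forall c, D (rot_site G c) = D c;
  periodic_site : forall c, #|porbit (rot_site G) c| = N;
  periodic_mark : forall m, #|porbit (rot_mark G) m| = N;
  periodic_turn : forall a k, (0 < k < N)%N -> iter k rot_strand a \in component a ->
    exists z l, [/\ z.1 \in component a, fingraph.order face z = (l * N)%N
                 & rot_dart z = iter l face z] }.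

(** * The Khovanov complex *)

(* A Kauffman state is given by the set S of its 1-smoothed crossings.  It is
   horizontal (NW-NE and SW-SE are joined) at the crossings where it is not the
   oriented resolution. *)
Definition horizontal (S : {set site G}) (v : strand G) : bool :=
  match v with
  | inl (c, _) => match D c with
                  | Positive => c \in S
                  | Negative => c \notin S
                  | Smoothed => false
                  end
  | inr _ => false
  end.

Definition smoothing_adjacent (S : {set site G}) (a b : strand G) : bool :=
  [|| (b == next G a) && ~~ horizontal S b,
      (b == opposite a) && horizontal S a
    | (next G b == opposite (next G a)) && horizontal S (next G a)].

(* A circle is the set of its arcs. *)
Definition circles (S : {set site G}) : {set {set strand G}} :=
  classes (smoothing_adjacent S).

(* The canonical basis of CKh: pairs (S, P) of a state S and the set P of its
   circles labelled by v_+ (other circles are labelled by v_-).  The factor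
   of the exterior power is generated by the wedge product of the elements of S,
   in the increasing order of [enum_rank]. *)
Definition labelled : finType := ({set site G} * {set {set strand G}})%type.

Definition is_generator (u : labelled) : bool :=
  (u.1 \subset crossings) && (u.2 \subset circles u.1).

Definition label_degree (u : labelled) : int :=
  #|u.2|%:Z - #|circles u.1 :\: u.2|%:Z.

Definition bidegree (u : labelled) : int * int :=
  (#|u.1|%:Z - nneg%:Z,
   label_degree u + #|u.1|%:Z + npos%:Z - (2 * nneg)%:Z).

Definition generator (i j : int) : finType :=
  {u : labelled | is_generator u && (bidegree u == (i, j))}.

Definition CKh (i j : int) : vectType rat := {ffun generator i j -> rat^o}.

(* The linear map whose value at the generator u is \sum_v k u v v. *)
Definition linmap i j i' j' (k : labelled -> labelled -> rat) :
    'Hom(CKh i j, CKh i' j') :=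
  linfun (fun f : CKh i j =>
    [ffun v => \sum_u f u * k (val u) (val v)] : CKh i' j').

(* Structure constants of A, true standing for v_+: [mulA a b c] is the
   coefficient of v_c in v_a v_b, and [comulA a b c] that of v_b (x) v_c in the
   coproduct of v_a. *)
Definition mulA (a b c : bool) : rat :=
  ((a && b && c) || ((a (+) b) && ~~ c))%:R.
Definition comulA (a b c : bool) : rat :=
  (if a then b (+) c else ~~ b && ~~ c)%:R.

(* The merge or split map; the circles that do not meet the changed crossing
   belong to both states. *)
Definition edge_coef (u v : labelled) : rat :=
  let T := circles u.1 :\: circles v.1 in
  let T' := circles v.1 :\: circles u.1 in
  if u.2 :\: T == v.2 :\: T' then
    match enum T, enum T' with
    | [:: C1; C2], [:: C] => mulA (C1 \in u.2) (C2 \in u.2) (C \in v.2)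
    | [:: C], [:: C1; C2] => comulA (C \in u.2) (C1 \in v.2) (C2 \in v.2)
    | _, _ => 0
    end
  else 0.

(* Exterior multiplication by c on the left. *)
Definition wedge_sign (c : site G) (S : {set site G}) : rat :=
  (-1) ^+ #|[set c' in S | (enum_rank c' < enum_rank c)%N]|.

Definition khdiff_coef (u v : labelled) : rat :=
  \sum_(c in crossings :\: u.1 | v.1 == c |: u.1)
    wedge_sign c u.1 * edge_coef u v.

(* CKh^{i,j} -> CKh^{i',j}, to be used with i' = i + 1. *)
Definition khdiff (i i' j : int) : 'Hom(CKh i j, CKh i' j) :=
  linmap i j i' j khdiff_coef.

(* The sign of the permutation that sorts the image of S under the rotation. *)
Definition rot_sign (S : {set site G}) : rat :=
  (-1) ^+ #|[set x in setX S S | (enum_rank x.1 < enum_rank x.2)%N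
              && (enum_rank (rot_site G x.2) < enum_rank (rot_site G x.1))%N]|.

Definition rot_coef (u v : labelled) : rat :=
  if (v.1 == rot_site G @: u.1)
     && (v.2 == [set rot_strand @: (C : {set strand G}) | C in u.2])
  then rot_sign u.1 else 0.

(* The action of the generator of Z/N. *)
Definition rotCKh (i j : int) : 'End(CKh i j) := linmap i j i j rot_coef.

End Diagram.

(** * Cyclotomic fields and their Hom spaces *)

Lemma cyclotomic_irreducible (d : nat) :
  monic_irreducible_poly (map_poly intr 'Phi_d.-1.+1 : {poly rat}).
Proof.
set n := d.-1.+1; have [z prim_z] := C_prim_root_exists (isT : (0 < n)%N).
have [p [Dp mon_p] dv_p] := minCpolyP z.
have Dphi : map_poly intr 'Phi_n = p :> {poly rat}.
  apply: (map_inj_poly (fmorph_inj (@ratr algC)) (rmorph0 _)).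
  rewrite -Dp (minCpoly_cyclotomic prim_z) -(Cintr_Cyclotomic prim_z).
  by rewrite -map_poly_comp; apply: eq_map_poly => b; rewrite /= rmorph_int.
rewrite Dphi; split=> //; split.
  have := size_minCpoly z; rewrite Dp size_map_inj_poly ?rmorph0 //.
  exact: fmorph_inj.
move=> f size_f /dvdpP[g Dpg]; rewrite Dpg.
have nz_p := monic_neq0 mon_p.
have [nz_g nz_f] : g != 0 /\ f != 0.
  by apply/andP; rewrite -negb_or -mulf_eq0 -Dpg.
have : root (map_poly ratr p) z by rewrite dv_p.
rewrite Dpg rmorphM rootM !dv_p => /orP[] /dvdp_leq.
  move=> /(_ nz_g); rewrite Dpg size_mul // => le_sz.
  have := size_f; rewrite -size_poly_gt0 in nz_f *; rewrite -size_poly_gt0 in nz_g.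
  move: le_sz nz_f nz_g; case: (size f) => [|[|k]] //.
  by case: (size g) => // m; rewrite addnS /= addnS ltnNge leq_addr.
move=> /(_ nz_f); rewrite Dpg => le_sz.
rewrite -dvdp_size_eqp ?dvdp_mull // eqn_leq le_sz andbT.
by rewrite dvdp_leq ?dvdp_mull // mulf_neq0.
Qed.

(* Q[xi_d] = Q[X] / Phi_d with xi_d the class of X, for d > 0 (d = 0 is read
   as d = 1). *)
Definition Qxi (d : nat) : fieldExtType rat :=
  {poly %/ map_poly intr 'Phi_d.-1.+1 with cyclotomic_irreducible d}.
Definition xi (d : nat) : Qxi d := 'qX.

(* Hom_Q(L, C), as a vector space over L acting on the source. *)
Definition cycHom (L : fieldExtType rat) (C : vectType rat) := 'Hom(L, C).

Section CycHom.
Variables (L : fieldExtType rat) (C : vectType rat).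

HB.instance Definition _ := GRing.Zmodule.on (cycHom L C).

Definition cyc_scale (a : L) (f : cycHom L C) : cycHom L C := (f \o amull a)%VF.

Lemma cyc_scaleE a f x : (cyc_scale a f : 'Hom(L, C)) x = (f : 'Hom(L, C)) (a * x).
Proof. by rewrite comp_lfunE lfunE. Qed.

Fact cyc_scaleA a b f : cyc_scale a (cyc_scale b f) = cyc_scale (a * b) f.
Proof. by apply/lfunP=> x; rewrite !cyc_scaleE mulrCA mulrA. Qed.
Fact cyc_scale1 : left_id 1 cyc_scale.
Proof. by move=> f; apply/lfunP=> x; rewrite cyc_scaleE mul1r. Qed.
Fact cyc_scaleDr : right_distributive cyc_scale +%R.
Proof. by move=> a f g; apply/lfunP=> x; rewrite add_lfunE !cyc_scaleE add_lfunE. Qed.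
Fact cyc_scaleDl f : {morph cyc_scale^~ f : a b / a + b}.
Proof.
by move=> a b; apply/lfunP=> x; rewrite add_lfunE !cyc_scaleE mulrDl linearD.
Qed.

HB.instance Definition _ := GRing.Zmodule_isLmodule.Build L (cycHom L C)
  cyc_scaleA cyc_scale1 cyc_scaleDr cyc_scaleDl.

(* Finite dimension over L: for a basis e of C over rat and a nonzero linear form
   t on L, c |-> (x |-> \sum_i t (c_i x) e_i) is an L-linear isomorphism from L^m
   to Hom_Q(L, C). *)
Let m := \dim {:C}.
Let e : m.-tuple C := vbasis {:C}.
Let k0 : 'I_(\dim {:L}) := Ordinal (adim_gt0 {:L}).
Let t (x : L) : rat := coord (vbasis {:L}) k0 x.

Definition cyc_fun (c : {ffun 'I_m -> L}) (x : L) : C :=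
  \sum_i t (c i * x) *: e`_i.

Fact cyc_fun_linear c : linear (cyc_fun c).
Proof.
move=> a x y; rewrite /cyc_fun scaler_sumr -big_split; apply: eq_bigr => i _ /=.
by rewrite scalerA -scalerDl /t mulrDr -scalerAr linearP.
Qed.
HB.instance Definition _ c := GRing.isLinear.Build rat L C _ (cyc_fun c)
  (cyc_fun_linear c).

Definition cyc_lfun (c : {ffun 'I_m -> L}) : 'Hom(L, C) := linfun (cyc_fun c).

Fact cyc_lfun_linear : linear cyc_lfun.
Proof.
move=> a b c; apply/lfunP=> x; rewrite add_lfunE scale_lfunE !lfunE /= /cyc_fun.
rewrite scaler_sumr -big_split; apply: eq_bigr => i _ /=.
by rewrite scalerA -scalerDl !ffunE /t mulrDl -scalerAl linearP.
Qed.
HB.instance Definition _ := GRing.isLinear.Build rat {ffun 'I_m -> L} 'Hom(L, C)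
  _ cyc_lfun cyc_lfun_linear.

Let Psi := linfun cyc_lfun.

Fact cyc_Psi_ker : lker Psi == 0%VS.
Proof.
apply/lker0P=> b c; rewrite !lfunE /= => /lfunP eq_bc; apply/ffunP=> i.
apply/eqP; rewrite -subr_eq0; apply/negP=> /negP nz_bc.
have e_free : free e by exact: basis_free (vbasisP _).
have y_free : free (vbasis {:L}) by exact: basis_free (vbasisP _).
pose y := (vbasis {:L})`_k0; have := eq_bc ((b i - c i)^-1 * y).
rewrite !lfunE /= => /(congr1 (coord e i)); rewrite !coord_sum_free //.
move/eqP; rewrite -subr_eq0 /t -linearB -mulrBl mulrA divff // mul1r.
by rewrite /= /y coord_free // eqxx oner_eq0.
Qed.

Fact cyc_Psi_full : limg Psi = fullv.
Proof.
apply/eqP; rewrite eqEdim subvf /= limg_dim_eq; last first.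
  by rewrite (eqP cyc_Psi_ker) capv0.
rewrite !dimvf; change (dim L * dim C <= #|'I_m| * dim L)%N.
by rewrite card_ord /m dimvf mulnC.
Qed.

Let PsiVK : cancel Psi^-1%VF Psi.
Proof. by move=> f; rewrite limg_lfunVK ?cyc_Psi_full ?memvf. Qed.
Let PsiK : cancel Psi Psi^-1%VF.
Proof. exact: lker0_lfunK cyc_Psi_ker. Qed.

Fact cyc_Psi_scale a (b : {ffun 'I_m -> L}) :
  Psi [ffun i => a * b i] = cyc_scale a (Psi b).
Proof.
apply/lfunP=> x; rewrite cyc_scaleE !lfunE /= /cyc_fun.
by apply: eq_bigr => i _; rewrite ffunE mulrCA mulrA.
Qed.

Fact cycHom_vect_axiom : Vector.axiom m (cycHom L C).
Proof.
exists (fun f : cycHom L C => \row_i (Psi^-1%VF (f : 'Hom(L, C))) i).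
  move=> a f g; apply/rowP=> i; rewrite !mxE -[in RHS]/(a * _).
  have -> : Psi^-1%VF (a *: f + g : 'Hom(L, C))
      = [ffun i => a * Psi^-1%VF (f : 'Hom(L, C)) i] + Psi^-1%VF (g : 'Hom(L, C)).
    apply: (can_inj PsiK); rewrite PsiVK [RHS]linearD; symmetry.
    by congr (_ + _); [rewrite [LHS]cyc_Psi_scale PsiVK | exact: PsiVK].
  by rewrite !ffunE.
exists (fun c : 'rV[L]_m => Psi [ffun i => c 0 i]) => [f | c].
  rewrite -[RHS]PsiVK; congr (Psi _).
  by apply/ffunP=> i; rewrite ffunE mxE.
by apply/rowP=> i; rewrite mxE PsiK ffunE.
Qed.

HB.instance Definition _ := Lmodule_hasFinDim.Build L (cycHom L C)
  cycHom_vect_axiom.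

End CycHom.

(** * Equivariant Khovanov homology and Jones polynomials *)

Section Equivariant.
Variables (G : shadow) (D : diagram G) (d : nat).

(* Hom_{Q[Z/N]} (Q[xi_d], CKh^{i,j}): linear maps commuting with the action of
   the generator. *)
Definition homCKh (i j : int) : {vspace cycHom (Qxi d) (CKh D i j)} :=
  lker (linfun (fun f : cycHom (Qxi d) (CKh D i j) =>
    (rotCKh D i j \o f)%VF - (f \o amull (xi d))%VF :
      cycHom (Qxi d) (CKh D i j))).

Definition diff_homCKh (i i' j : int) :
    'Hom(cycHom (Qxi d) (CKh D i j), cycHom (Qxi d) (CKh D i' j)) :=
  linfun (fun f : cycHom (Qxi d) (CKh D i j) =>
    (khdiff D i i' j \o f)%VF : cycHom (Qxi d) (CKh D i' j)).

Definition cocycles (i j : int) :=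
  (lker (diff_homCKh i (i + 1) j) :&: homCKh i j)%VS.

Definition coboundaries (i j : int) :=
  (diff_homCKh (i - 1) i j @: homCKh (i - 1) j)%VS.

(* The dimension over Q[xi_d] of the quotient Kh^{i,j,d} of the cocycles by the
   coboundaries (a subspace, as d o d = 0 for planar diagrams and d commutes with
   the rotation). *)
Definition dimKh (i j : int) : int :=
  (\dim (cocycles i j))%:Z - (\dim (coboundaries i j))%:Z.

End Equivariant.

(* Laurent polynomials in q over Z are viewed in the fraction field of Z[q]. *)
Notation Zq := {fraction {poly int}}.
Definition q : Zq := tofrac 'X.

Definition is_laurent (f : Zq) : Prop :=
  exists (P : {poly int}) (k : nat), f = tofrac P / q ^+ k.

(* f = g modulo h in Z[q, q^-1]. *)
Definition laurent_eqmod (f g h : Zq) : Prop :=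
  exists2 a, is_laurent a & f - g = a * h.

(* The pairs (i, j) with CKh^{i,j} <> 0. *)
Definition bidegrees (G : shadow) (D : diagram G) : seq (int * int) :=
  undup [seq bidegree D u | u <- enum (is_generator D)].

(* J_{N,d}(D); the group order N is determined by the rotation of the shadow. *)
Definition J (G : shadow) (d : nat) (D : diagram G) : Zq :=
  \sum_(ij <- bidegrees D) (-1) ^ ij.1 * q ^ ij.2 * (dimKh D d ij.1 ij.2)%:~R.

Definition DJ (p n s : nat) (G : shadow) (D : diagram G) : Zq :=
  J (p ^ s) D - (if s == n then 0 else J (p ^ s.+1) D).

(* Main.v *)
From HB Require Import structures.
Require Import Defs.
From mathcomp Require Import all_boot all_order all_algebra all_fingroup all_field.
From mathcomp Require Import zify.
Set Implicit Arguments.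
Unset Strict Implicit.
Unset Printing Implicit Defensive.
Import Order.TTheory GRing.Theory Num.Theory.
Local Open Scope ring_scope.

(* In the alternating sum over i, dim (cocycles) - dim (coboundaries) telescopes to
   the dimension of Hom_{Q[Z/N]}(Q[xi_d], CKh^{i,j}), whatever the differential.
   CKh is a signed permutation representation on the generators (S, P); as N = p^n
   is odd, no orbit carries a nontrivial sign, so an orbit contributes 1 if d divides
   its length and 0 otherwise.  Hence DJ_{n,s} is the sum of (-1)^i q^j over the
   orbits of length exactly p^s.

   Toggling the smoothings at the distinguished orbit is an equivariant bijection
   between the generators of D+ and those of D-, while the generators of D0 are those
   of D+ without 1-smoothing there.  A generator of D+ of weight w with t 1-smoothings
   in the distinguished orbit contributes w (q^(-2N) - q^(-2t)) to the difference of
   the two sides if t > 0, and 0 if t = 0.  If its orbit has length p^(n-s) then p^s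
   divides t, which gives the congruence; for s = n this forces t = N, and the
   contribution vanishes. *)

(** * Cyclotomic fields *)

Lemma in_qpoly_eq0 (F : fieldType) (h f : {poly F}) :
  monic_irreducible_poly h -> (in_qpoly h f == 0) = (h %| f).
Proof.
(* [mk_monic] falls back to ['X] unless its argument is monic and nonconstant, which both hold
   here. *)
case=> irr_h mon_h; have mkE : mk_monic h = h by rewrite /mk_monic mon_h irr_h.1.
by rewrite -val_eqE /= -Pdiv.IdomainMonic.modpE mkE.
Qed.

(** The cyclotomic polynomial is the minimal polynomial of a primitive complex root [z], so it
    divides ['X^m - 1] exactly when [z ^+ m = 1]. *)
Lemma xi_exp_eq1 d m : (0 < d)%N -> (xi d ^+ m == 1) = (d %| m)%N.
Proof.
case: d => // d _; set n := d.+1.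
have [z prim_z] := C_prim_root_exists (isT : (0 < n)%N).
have [p [Dp mon_p] dv_p] := minCpolyP z.
have Dphi : map_poly intr 'Phi_n = p :> {poly rat}.
  apply: (map_inj_poly (fmorph_inj (@ratr algC)) (rmorph0 _)).
  rewrite -Dp (minCpoly_cyclotomic prim_z) -(Cintr_Cyclotomic prim_z).
  by rewrite -map_poly_comp; apply: eq_map_poly => b; rewrite /= rmorph_int.
rewrite -subr_eq0.
have -> : xi n ^+ m - 1 = in_qpoly (map_poly intr 'Phi_n) ('X^m - 1) :> Qxi n.
  rewrite (rmorphB (in_qpoly _)) (rmorphXn (in_qpoly _)); congr (_ - _).
  exact: (esym (in_qpoly1 _)).
rewrite [LHS](in_qpoly_eq0 _ (cyclotomic_irreducible n)) Dphi -dv_p.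
rewrite rmorphB rmorph1 /= map_polyXn rootE !hornerE subr_eq0.
by rewrite (prim_order_dvd prim_z).
Qed.

(** * Orbits of a permutation *)

Section Orbits.
Variables (X : finType) (s : {perm X}).

Lemma permX_porbit x : (s ^+ #|porbit s x|)%g x = x.
Proof. by rewrite permX iter_porbit. Qed.

Lemma porbit_dvdn k x : ((s ^+ k)%g x == x) = (#|porbit s x| %| k)%N.
Proof.
have itm j : (s ^+ (j * #|porbit s x|))%g x = x.
  by elim: j => [|j IH]; rewrite ?perm1 // mulSn expgD permM permX_porbit.
rewrite {1}(divn_eq k #|porbit s x|) expgD permM itm /dvdn.
set r := (k %% _)%N; have lt_r : (r < #|porbit s x|)%N.
  by rewrite ltn_mod lt0n card_porbit_neq0.
apply/eqP/eqP => [fix_r|->]; last by rewrite perm1.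
have m_gt0 : (0 < #|porbit s x|)%N by rewrite lt0n card_porbit_neq0.
have := nth_uniq x _ _ (uniq_traject_porbit s x); rewrite size_traject.
move=> /(_ _ _ lt_r m_gt0); rewrite !nth_traject //= -permX fix_r eqxx.
by move/esym/eqP.
Qed.

(** [pick] sees only the orbit as a set, so all points of an orbit get the same representative; the
    default is never reached, since an orbit contains its base point. *)
Definition porbit_repr x := odflt x [pick y in porbit s x].

Lemma porbit_repr_mem x : porbit_repr x \in porbit s x.
Proof.
by rewrite /porbit_repr; case: pickP => [y // | /(_ x)]; rewrite porbit_id.
Qed.

Lemma porbit_repr_eq x y : y \in porbit s x -> porbit_repr y = porbit_repr x.
Proof.
rewrite -eq_porbit_mem => /eqP e; rewrite /porbit_repr e.
by case: pickP => // /(_ x); rewrite porbit_id.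
Qed.

Lemma porbit_repr_id x : porbit_repr (porbit_repr x) = porbit_repr x.
Proof. exact/porbit_repr_eq/porbit_repr_mem. Qed.

(** The weights 1/length add up to 1 on each orbit. Sums over orbits can thus be written as sums
    over all points, which are easier to reindex and to compare. *)
Lemma sum_porbit_repr (F : fieldType) (A : pred X) (f : X -> F) :
    [pchar F] =i pred0 ->
    (forall x, A (s x) = A x) -> (forall x, f (s x) = f x) ->
  \sum_(x | A x) f x / #|porbit s x|%:R = \sum_(x | A x && (porbit_repr x == x)) f x.
Proof.
move=> F0 As fs; pose inv T (g : X -> T) := forall x y, y \in porbit s x -> g y = g x.
have invI T (g : X -> T) : (forall x, g (s x) = g x) -> inv T g.
  move=> gs x _ /porbitP[k ->]; elim: k => [|k IH]; first by rewrite perm1.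
  by rewrite expgSr permM gs.
rewrite (partition_big porbit_repr (fun x => A x && (porbit_repr x == x))) /=; last first.
  by move=> x Ax; rewrite porbit_repr_id eqxx (invI _ _ As _ _ (porbit_repr_mem x)) Ax.
apply: eq_bigr => y /andP[Ay /eqP ry].
transitivity (\sum_(x in porbit s y) f y / #|porbit s y|%:R).
  apply: eq_big => [x | x /andP[_ /eqP rx]].
    apply/andP/idP => [[_ /eqP <-] | xy]; first by rewrite porbit_sym porbit_repr_mem.
    by rewrite (invI _ _ As _ _ xy) (porbit_repr_eq xy) ry.
  have yx : y \in porbit s x by rewrite -rx porbit_repr_mem.
  by rewrite (invI _ _ fs _ _ yx); move: yx; rewrite -eq_porbit_mem => /eqP->.
rewrite sumr_const -[LHS]mulr_natr divfK //.
by rewrite ((pcharf0P F).1 F0) card_porbit_neq0.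
Qed.

Section Cocycle.
Variables (L : comNzRingType) (w : X -> L).

(** The factor gained along [k] steps by a function that [s] multiplies by [w], see
    [cocycle_exp]. *)
Definition cocycle k x := \prod_(l < k) w ((s ^+ l)%g x).

Lemma cocycle0 x : cocycle 0 x = 1.
Proof. exact: big_ord0. Qed.

Lemma cocycleSr k x : cocycle k.+1 x = cocycle k x * w ((s ^+ k)%g x).
Proof. exact: big_ord_recr. Qed.

Lemma cocycleD j k x : cocycle (j + k) x = cocycle j x * cocycle k ((s ^+ j)%g x).
Proof.
elim: k => [|k IH]; first by rewrite addn0 cocycle0 mulr1.
by rewrite addnS !cocycleSr IH mulrA -permM -expgD.
Qed.

Lemma cocycleS k x : cocycle k.+1 x = w x * cocycle k (s x).
Proof. by rewrite (cocycleD 1) cocycleSr cocycle0 mul1r perm1 expg1. Qed.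

Lemma cocycle_muln j x :
  cocycle (j * #|porbit s x|) x = cocycle #|porbit s x| x ^+ j.
Proof.
elim: j => [|j IH]; first by rewrite cocycle0.
by rewrite mulSn cocycleD exprS permX_porbit IH.
Qed.

Lemma cocycle_exp (a : X -> L) :
  (forall x, a (s x) = w x * a x) -> forall k x, a ((s ^+ k)%g x) = cocycle k x * a x.
Proof.
move=> aS; elim=> [|k IH] x; first by rewrite perm1 cocycle0 mul1r.
by rewrite expgS permM IH aS cocycleS mulrCA mulrA.
Qed.

End Cocycle.

(* Along an orbit, an equivariant function is determined by its value at the
   representative, which is arbitrary when the cocycle around the orbit is 1 and
   vanishes otherwise. *)
Lemma dim_equivariant (L : fieldType) (w : X -> L) N (V : {vspace {ffun X -> L^o}}) :
    [pchar L] =i pred0 -> (0 < N)%N ->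
    (s ^+ N = 1)%g -> (forall x, cocycle w N x = 1) ->
    (forall a : {ffun X -> L^o},
      reflect (forall x, a (s x) = w x * a x) (a \in V)) ->
  \dim V = #|[pred x | (cocycle w #|porbit s x| x == 1) && (porbit_repr x == x)]|.
Proof.
move=> L0 N_gt0 sN cN inV; set good := [pred x | _].
have nz_w x : w x != 0.
  have := cN x; rewrite -(prednK N_gt0) cocycleS => e.
  by apply/eqP=> w0; move/eqP: e; rewrite w0 mul0r eq_sym oner_eq0.
have nz_c k x : cocycle w k x != 0 by apply/prodf_neq0 => i _.
pose R := {x | good x}.
(* Extension from representatives: each [k] that takes [x] to a representative [r] contributes
   [h r], transported back to [x]. Using every [k < N], not only the first hit, makes equivariance a
   cyclic shift of the sum, at the price of a multiplicity computed in [ER]. *)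
pose E (h : {ffun R -> L^o}) : {ffun X -> L^o} :=
  [ffun x => \sum_(k < N) \sum_(r : R | (s ^+ k)%g x == val r) h r / cocycle w k x].
have linE : linear E.
  move=> c g h; apply/ffunP=> x; rewrite !ffunE scaler_sumr -big_split /=.
  apply: eq_bigr => k _; rewrite scaler_sumr -big_split /=.
  by apply: eq_bigr => r _; rewrite !ffunE mulrDl -scalerAl.
pose El : {linear _ -> _} := HB.pack E (GRing.isLinear.Build _ _ _ _ E linE).
pose P (a : {ffun X -> L^o}) : {ffun R -> L^o} := [ffun r => a (val r)].
have linP : linear P by move=> c g h; apply/ffunP=> x; rewrite !ffunE.
pose Pl : {linear _ -> _} := HB.pack P (GRing.isLinear.Build _ _ _ _ P linP).
have EV h : E h \in V.
  apply/inV=> x; rewrite !ffunE mulr_sumr.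
  pose g k := \sum_(r : R | (s ^+ k)%g x == val r) w x * (h r / cocycle w k x).
  transitivity (\sum_(k < N) g k.+1).
    apply: eq_bigr => k _; apply: eq_big => [r|r _]; first by rewrite expgS permM.
    by rewrite cocycleS invfM mulrCA mulVKf.
  transitivity (\sum_(k < N) g k); last by apply: eq_bigr => k _; rewrite mulr_sumr.
  (* The two sums differ only by their end terms [g 0] and [g N], which agree because [s ^+ N = 1]
     and the cocycle of length [N] is 1. *)
  have e : g 0%N + \sum_(k < N) g k.+1 = \sum_(k < N) g k + g N.
    by rewrite -(big_ord_recl N (fun k => g k)) -(big_ord_recr N (fun k => g k)).
  have g0N : g N = g 0%N by apply: eq_big => r; rewrite sN ?cN ?cocycle0.
  by apply: (addrI (g 0%N)); rewrite [LHS]e g0N addrC.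
have ER h r : E h (val r) = h r *+ #|[pred k : 'I_N | (#|porbit s (val r)| %| k)%N]|.
  rewrite ffunE -sumr_const [RHS]big_mkcond; apply: eq_bigr => k _.
  rewrite inE -porbit_dvdn; case: ifPn => [fix_r | mv_r].
    rewrite (big_pred1 r) => [|r']; last by rewrite /= (eqP fix_r) eq_sym.
    move: fix_r; rewrite porbit_dvdn => /dvdnP[j ->]; rewrite cocycle_muln.
    by have /andP[/eqP-> _] := valP r; rewrite expr1n divr1.
  rewrite big_pred0 // => r'; apply/negP=> /eqP e.
  have /andP[_ /eqP rr] := valP r; have /andP[_ /eqP rr'] := valP r'.
  have: val r' \in porbit s (val r) by rewrite -e mem_porbit.
  by move/porbit_repr_eq; rewrite rr rr' => e'; rewrite e e' eqxx in mv_r.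
have kerE : lker (linfun El) == 0%VS.
  rewrite -subv0; apply/subvP=> h; rewrite memv_ker lfunE /= memv0 => /eqP h0.
  apply/eqP/ffunP=> r; have /eqP := ER h r; rewrite h0 !ffunE eq_sym.
  rewrite -[X in X == 0]mulr_natr mulf_eq0 ((pcharf0P L).1 L0) => /orP[/eqP//|].
  (* The index 0 is always counted, so the multiplicity is nonzero in characteristic 0. *)
  by move/eqP/card0_eq/(_ (Ordinal N_gt0)); rewrite inE /= dvdn0.
have sR : #|{: R}| = #|good| by rewrite card_sig.
apply/eqP; rewrite eqn_leq; apply/andP; split.
  have <- : \dim (linfun Pl @: V) = \dim V.
    apply: limg_dim_eq; apply/eqP; rewrite -subv0; apply/subvP=> a.
    rewrite memv_cap memv_ker lfunE memv0 => /andP[/inV aS /eqP a0].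
    have ac := cocycle_exp aS; have aR y : porbit_repr y = y -> a y = 0.
      move=> ry; have [cy | ncy] := eqVneq (cocycle w #|porbit s y| y) 1.
        have gy : good y by rewrite /good /= cy ry !eqxx.
        by have /ffunP/(_ (exist _ y gy)) := a0; rewrite !ffunE.
      (* One turn around the orbit multiplies [a y] by a factor other than 1, hence [a y]
         vanishes. *)
      have := ac #|porbit s y| y; rewrite permX_porbit => /eqP.
      rewrite -subr_eq0 -{1}[a y]mul1r -mulrBl mulf_eq0 subr_eq0 eq_sym.
      by rewrite (negPf ncy) => /eqP.
    apply/eqP/ffunP=> x; rewrite ffunE; have /porbitP[k e] := porbit_repr_mem x.
    have := aR _ (porbit_repr_id x); rewrite e ac => /eqP.
    by rewrite mulf_eq0 (negPf (nz_c _ _)) => /eqP.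
  by apply: leq_trans (dimvS (subvf _)) _; rewrite dimvf /dim /= muln1 -sR.
rewrite -sR; apply: leq_trans (_ : \dim (linfun El @: fullv) <= _)%N.
  by rewrite limg_dim_eq ?(eqP kerE) ?capv0 // dimvf /dim /= muln1.
by apply: dimvS; apply/subvP=> _ /memv_imgP[h _ ->]; rewrite lfunE.
Qed.
End Orbits.

(** * Linear maps out of a field extension *)

(** Serves for maps given as bare functions, with linearity supplied as a proof rather than as a
    registered structure. *)
Lemma linfunE (R : nzRingType) (aT rT : vectType R) (f : aT -> rT) :
  linear f -> linfun f =1 f.
Proof.
move=> lin_f; pose fl : {linear aT -> rT} := HB.pack f (GRing.isLinear.Build _ _ _ _ f lin_f).
exact: (lfunE fl).
Qed.

Lemma pchar_fieldExt (L : fieldExtType rat) : [pchar L] =i pred0.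
Proof. by move=> p; rewrite pchar_lalg pchar_num. Qed.

(** A coordinate form takes the value 1 at its basis vector [y], and [b^-1 * y] exhibits this value
    for any nonzero [b]. *)
Lemma nondegenerate_form_exists (L : fieldExtType rat) :
  exists t : {linear L -> rat^o}, forall b, (forall x, t (b * x) = 0) -> b = 0.
Proof.
pose k0 : 'I_(\dim {:L}) := Ordinal (adim_gt0 {:L}).
exists (coord (vbasis {:L}) k0) => b tb; apply/eqP/negP=> /negP nz_b.
have := tb (b^-1 * (vbasis {:L})`_k0); rewrite mulrA divff // mul1r.
have fr : free (vbasis {:L}) by exact: basis_free (vbasisP _).
by move/(etrans (esym (coord_free k0 k0 fr)))/eqP; rewrite eqxx oner_eq0.
Qed.

(* A Q-linear map f : L -> Q^X is x |-> (t (a_u x))_u for a unique a in L^X, which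
   turns equivariance of f into equivariance of a. *)
Lemma dim_cycHom_equivariant (X : finType) (s : {perm X}) (sigma : X -> rat) N
    (L : fieldExtType rat) (z : L) (T : 'End({ffun X -> rat^o}))
    (H : {vspace cycHom L {ffun X -> rat^o}}) :
    let w u := sigma u *: z^-1 in
    (0 < N)%N -> (s ^+ N = 1)%g -> (forall x, cocycle s w N x = 1) -> z != 0 ->
    (forall f v, T f (s v) = sigma v * f v) ->
    (forall f : 'Hom(L, _), reflect (forall x, T (f x) = f (z * x)) (f \in H)) ->
  \dim H = #|[pred x | (cocycle s w #|porbit s x| x == 1) && (porbit_repr s x == x)]|.
Proof.
move=> w N_gt0 sN cN nz_z Ts inH; have [t tP] := nondegenerate_form_exists L.
(* With [al = a (s v)] and [be = a v], this turns the failure of equivariance of [a], multiplied by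
   [z * x], into an element whose image under [t] is the failure of equivariance of [f] at [x]. *)
have key (al be x : L) c : (al - c *: z^-1 * be) * z * x = al * (z * x) - c *: (be * x).
  rewrite !mulrBl mulrA; congr (_ - _); rewrite -!scalerAl; congr (_ *: (_ * _)).
  by rewrite mulrAC mulVf // mul1r.
pose psi (a : {ffun X -> L^o}) (x : L) : {ffun X -> rat^o} := [ffun u => t (@GRing.mul L (a u) x)].
have lin_psi a : linear (psi a).
  move=> c x y; apply/ffunP=> u; rewrite !ffunE.
  by rewrite mulrDr -scalerAr linearP.
pose Psi (a : {ffun X -> L^o}) : cycHom L {ffun X -> rat^o} := linfun (psi a).
have PsiE a x u : (Psi a : 'Hom(L, _)) x u = t (@GRing.mul L (a u) x) by rewrite linfunE // ffunE.
have lin_Psi : linear Psi.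
  move=> c a b; apply/lfunP=> x; apply/ffunP=> u.
  rewrite [RHS](congr1 (fun f : {ffun _ -> _} => f u) (add_lfunE _ _ _)).
  rewrite [RHS]ffunE [(c *: Psi a : 'Hom(L, _)) x](cyc_scaleE c (Psi a)) !PsiE !ffunE.
  by rewrite mulrDl linearD mulrCA mulrA.
pose P := linfun Psi.
have kerP : lker P == 0%VS.
  rewrite -subv0; apply/subvP=> a; rewrite memv_ker linfunE // memv0 => /eqP a0.
  apply/eqP/ffunP=> u; rewrite ffunE; apply: tP => x; rewrite -PsiE a0.
  have x0 : (0 : 'Hom(L, {ffun X -> rat^o})) x = 0 by rewrite zero_lfunE.
  transitivity ((0 : {ffun X -> rat^o}) u); last by rewrite ffunE.
  exact: (congr1 (fun f : {ffun X -> rat^o} => f u) x0).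
(* Source and target both have dimension [#|X|] over [L], so injectivity suffices. *)
have fullP : limg P = fullv.
  apply/eqP; rewrite eqEdim subvf /= limg_dim_eq ?(eqP kerP) ?capv0 //.
  rewrite !dimvf; change (\dim {: {ffun X -> rat^o}} <= #|X| * 1)%N.
  by rewrite dimvf.
have <- : \dim (P @^-1: H) = \dim H.
  rewrite -[in RHS](lpreimK (f := P) (W := H)) ?fullP ?subvf //.
  by rewrite limg_dim_eq // (eqP kerP) capv0.
apply: dim_equivariant sN cN _ => //; first exact: pchar_fieldExt.
move=> a; rewrite -memv_preim [P a]linfunE //; apply: (iffP (inH _)) => [e v | e x].
  apply/eqP; rewrite -subr_eq0; apply/eqP/(mulIf nz_z); rewrite mul0r.
  apply: tP => x; have := congr1 (fun f : {ffun X -> rat^o} => f (s v)) (e x).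
  rewrite Ts !PsiE => {}e.
  rewrite (key (a (s v)) (a v)).
  by rewrite linearB linearZ /= -e subrr.
apply/ffunP=> u; rewrite -[u](permKV s); set v := (s^-1)%g u.
have := key (a (s v)) (a v) x (sigma v); rewrite Ts !PsiE e subrr !mul0r.
by move/esym/eqP; rewrite subr_eq0 => /eqP->; rewrite linearZ.
Qed.

(** * Orbits and classes under equivariant maps *)

(** By [porbit_dvdn] the two orbit lengths have the same multiples. *)
Lemma card_porbit_equivariant (X Y : finType) (s : {perm X}) (t : {perm Y}) (f : X -> Y) x :
  injective f -> (forall x, f (s x) = t (f x)) -> #|porbit t (f x)| = #|porbit s x|.
Proof.
move=> f_inj fs; have fsk k : f ((s ^+ k)%g x) = (t ^+ k)%g (f x).
  by elim: k => [|k IH]; rewrite ?perm1 // !expgSr !permM fs IH.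
have e k : (#|porbit t (f x)| %| k)%N = (#|porbit s x| %| k)%N.
  by rewrite -!porbit_dvdn -fsk (inj_eq f_inj).
by apply/eqP; rewrite eqn_dvd e dvdnn -e dvdnn.
Qed.

Section SubPerm.
Variables (X : finType) (s : {perm X}) (P : pred X) (sP : forall x, P (s x) = P x).

Let sub_fun (x : {x | P x}) : {x | P x} := exist _ (s (val x)) (etrans (sP _) (valP x)).
Fact sub_fun_inj : injective sub_fun.
Proof. by move=> x y /(congr1 val)/perm_inj/val_inj. Qed.
Definition sub_perm : {perm {x | P x}} := perm sub_fun_inj.

Lemma val_sub_perm x : val (sub_perm x) = s (val x).
Proof. by rewrite permE. Qed.

Lemma val_sub_permX k x : val ((sub_perm ^+ k)%g x) = (s ^+ k)%g (val x).
Proof. by elim: k => [|k IH]; rewrite ?perm1 // !expgSr !permM val_sub_perm IH. Qed.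

Lemma card_porbit_sub_perm x : #|porbit sub_perm x| = #|porbit s (val x)|.
Proof.
by symmetry; apply: card_porbit_equivariant val_inj val_sub_perm.
Qed.
End SubPerm.

Lemma connect_homo (T T' : finType) (e : rel T) (e' : rel T') (f : T -> T') x y :
  (forall a b, e a b -> e' (f a) (f b)) -> connect e x y -> connect e' (f x) (f y).
Proof.
move=> ef /connectP[l l_path ->]; apply/connectP; exists (map f l); last by rewrite last_map.
elim: l x l_path => //= a l IH x /andP[xa /IH->]; by rewrite ef.
Qed.

(** Connectivity is carried along [f] and, since [T] is finite, back along its inverse. *)
Lemma classes_bij (T : finType) (e e' : rel T) (f : T -> T) :
  injective f -> (forall a b, e' (f a) (f b) = e a b) ->
  Defs.classes e' = [set f @: (C : {set T}) | C in Defs.classes e].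
Proof.
move=> f_inj ef; have [g gK fK] := injF_bij f_inj.
pose c (e0 : rel T) := connect (fun a b => e0 a b || e0 b a).
have cf x y : c e' (f x) (f y) = c e x y.
  apply/idP/idP => /connect_homo h; last by apply: h => a b; rewrite !ef.
  by rewrite -[x]gK -[y]gK; apply: h => a b; rewrite -{1 2}[a]fK -{1 2}[b]fK !ef.
have fC x : f @: [set y | c e x y] = [set y | c e' (f x) y].
  apply/setP=> y; rewrite -[y]fK mem_imset // !inE; exact: esym (cf _ _).
apply/setP=> A; apply/imsetP/imsetP => [[x _ ->] | [_ /imsetP[x _ ->] ->]].
  exists [set y | c e (g x) y]; last by rewrite fC fK.
  by apply/imsetP; exists (g x).
by exists (f x); rewrite ?fC.
Qed.

(** * Signs of the rotation on the exterior powers *)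

Section Tournament.
Variables (T : finType) (R : comNzRingType).

Definition tournament (lt : rel T) :=
  forall x y, x != y -> lt x y = ~~ lt y x.

(** Each tournament selects one of [(x, y)] and [(y, x)] for every unordered pair. Pairs on which
    both agree are kept; the others are swapped, which the symmetry of [f] allows. *)
Lemma prod_tournament (S : {set T}) (lt lt' : rel T) (f : T -> T -> R) :
    tournament lt -> tournament lt' -> irreflexive lt -> irreflexive lt' ->
    (forall x y, f x y = f y x) ->
  \prod_(x in setX S S | lt x.1 x.2) f x.1 x.2
    = \prod_(x in setX S S | lt' x.1 x.2) f x.1 x.2.
Proof.
move=> tlt tlt' irr irr' fC.
rewrite (bigID (fun x => lt' x.1 x.2)) [RHS](bigID (fun x => lt x.1 x.2)) /=.
congr (_ * _); first by apply: eq_bigl => x; rewrite andbAC.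
pose sw (x : T * T) := (x.2, x.1).
have swK : involutive sw by case.
rewrite (reindex_inj (inv_inj swK)) /=; apply: eq_big => [[x y] | [x y] _] /=; last exact: fC.
rewrite !inE /= [(y \in S) && _]andbC -!andbA; congr [&& _, _ & _].
have [-> | ne_xy] := eqVneq x y; first by rewrite irr irr'.
by rewrite (tlt _ _ ne_xy) (tlt' _ _ ne_xy) negbK andbC.
Qed.
End Tournament.

Section RotSign.
Variable G : shadow.
Local Notation rho := (rot_site G).

Let lt (x y : site G) := (enum_rank x < enum_rank y)%N.

Let lt_tour (f : site G -> site G) : injective f -> tournament (fun x y => lt (f x) (f y)).
Proof.
move=> f_inj x y ne_xy; rewrite /lt -leqNgt ltn_neqAle.
by rewrite val_eqE (inj_eq enum_rank_inj) (inj_eq f_inj) ne_xy.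
Qed.

Let lt_irr : irreflexive lt.
Proof. by move=> x; rewrite /lt ltnn. Qed.

(** [rot_sign] counts inverted pairs. Pulled back to [S], the pairs no longer depend on [k], and the
    factor of a pair records whether its order changes between the steps [k] and [k.+1]. *)
Lemma rot_sign_iter k (S : {set site G}) :
  rot_sign [set (rho ^+ k)%g c | c in S] =
    \prod_(x in setX S S | lt x.1 x.2)
      (-1) ^+ (lt ((rho ^+ k)%g x.1) ((rho ^+ k)%g x.2)
               (+) lt ((rho ^+ k.+1)%g x.1) ((rho ^+ k.+1)%g x.2)).
Proof.
pose f x y : rat := (-1) ^+ (lt x y (+) lt (rho x) (rho y)).
have fC x y : f x y = f y x.
  have [-> // | ne_xy] := eqVneq x y.
  rewrite /f [lt x y](lt_tour (f := id)) // [lt (rho x) _](lt_tour (@perm_inj _ rho)) //.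
  by rewrite addNb addbN negbK.
transitivity (\prod_(x in setX S S | lt ((rho ^+ k)%g x.1) ((rho ^+ k)%g x.2))
    f ((rho ^+ k)%g x.1) ((rho ^+ k)%g x.2)); last first.
  (* Replaces the order transported by [rho ^+ k] with the fixed order [lt]. *)
  have e := @prod_tournament _ _ S (fun x y => lt ((rho ^+ k)%g x) ((rho ^+ k)%g y)) lt
              (fun x y => f ((rho ^+ k)%g x) ((rho ^+ k)%g y)).
  rewrite [LHS]e //; first by apply: eq_bigr => x _; rewrite /f !expgSr !permM.
  - exact/lt_tour/perm_inj.
  - exact: (lt_tour (f := id)).
set S' := imset _ _.
transitivity (\prod_(x in setX S' S' | lt x.1 x.2) f x.1 x.2).
  rewrite /rot_sign -prodr_const big_mkcond [RHS]big_mkcond /=.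
  apply: eq_bigr => -[x y] _; rewrite !inE /= -/(lt x y) -/(lt (rho y) (rho x)) /f.
  case: ((x \in S') && (y \in S')) => //=; have [lt_xy | //] := boolP (lt x y).
  have [e | ne_xy] := eqVneq x y; first by rewrite e lt_irr in lt_xy.
  rewrite [lt (rho x) _](lt_tour (@perm_inj _ rho)) //.
  by case: (lt (rho y) _).
pose F (x : site G * site G) := ((rho ^+ k)%g x.1, (rho ^+ k)%g x.2).
have F_inj : injective F by move=> [a b] [c d] [/perm_inj-> /perm_inj->].
rewrite (reindex_inj F_inj) /=; apply: eq_bigl => x.
by rewrite !inE /= !mem_imset //; exact: perm_inj.
Qed.

(** For each fixed pair the order changes telescope, and after [N] steps the pair is back in its
    original order. *)
Lemma prod_rot_sign N (S : {set site G}) :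
  (rho ^+ N)%g = 1%g -> \prod_(k < N) rot_sign [set (rho ^+ k)%g c | c in S] = 1.
Proof.
move=> rN; under eq_bigr do rewrite rot_sign_iter.
rewrite exchange_big big1 //= => x _; pose b k := lt ((rho ^+ k)%g x.1) ((rho ^+ k)%g x.2).
have tele j : \prod_(k < j) (-1) ^+ (b k (+) b k.+1) = (-1) ^+ (b 0%N (+) b j) :> rat.
  elim: j => [|j IH]; first by rewrite big_ord0 addbb.
  by rewrite big_ord_recr /= IH -signr_addb addbA -[X in X (+) _]addbA addbb addbF.
by rewrite tele /b rN expg0 addbb.
Qed.

Lemma rot_sign_sqr (S : {set site G}) : rot_sign S ^+ 2 = 1.
Proof. by rewrite -exprM mulnC exprM sqrrN expr1n. Qed.
End RotSign.

(** * The rotation of a periodic diagram *)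

Section Rotation.
Variable G : shadow.

Lemma rot_strand_inj : injective (@rot_strand G).
Proof. by move=> [[c b]|m] [[c' b']|m'] //= [] => [/perm_inj-> ->|/perm_inj->]. Qed.

Lemma opposite_rot (v : strand G) : opposite (rot_strand v) = rot_strand (opposite v).
Proof. by case: v => [[]|]. Qed.

Lemma iter_rot_strand k (v : strand G) :
  iter k (@rot_strand G) v = match v with
    | inl (c, b) => inl ((rot_site G ^+ k)%g c, b)
    | inr m => inr ((rot_mark G ^+ k)%g m)
    end.
Proof.
elim: k => [|k IH]; first by case: v => [[c b]|m]; rewrite /= perm1.
by rewrite iterS IH; case: v {IH} => [[c b]|m]; rewrite /= expgSr permM.
Qed.

Definition rot_state (u : labelled G) : labelled G :=
  (rot_site G @: u.1, [set (@rot_strand G) @: (C : {set strand G}) | C in u.2]).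

Fact rot_state_inj : injective rot_state.
Proof.
have := imset_inj (imset_inj rot_strand_inj).
by move=> h [S P] [S' P'] [/(imset_inj perm_inj)-> /h->].
Qed.

(** The permutation underlying [rotCKh], without its signs. It is defined on all labelled states of
    the shadow, so that diagrams on one shadow share the same orbits. *)
Definition rot_labelled : {perm labelled G} := perm rot_state_inj.

Lemma rot_labelledX k (u : labelled G) : (rot_labelled ^+ k)%g u =
  ([set (rot_site G ^+ k)%g c | c in u.1],
   [set [set iter k (@rot_strand G) a | a in (C : {set strand G})] | C in u.2]).
Proof.
elim: k => [|k IH].
  rewrite perm1 [u]surjective_pairing; congr (_, _); rewrite -[LHS]imset_id.
    by apply: eq_imset => x; rewrite perm1.
  by apply: eq_imset => C; rewrite -[LHS]imset_id.
rewrite expgSr permM IH permE /rot_state /= -!imset_comp; congr (_, _).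
  by apply: eq_imset => x; rewrite /= expgSr permM.
by apply: eq_imset => C; rewrite /= -imset_comp.
Qed.

Lemma horizontal_rot (D : diagram G) (S : {set site G}) v :
  (forall c, D (rot_site G c) = D c) ->
  horizontal D (rot_site G @: S) (rot_strand v) = horizontal D S v.
Proof.
move=> Drot; case: v => [[c b]|m] //=; rewrite Drot.
by rewrite mem_imset //; exact: perm_inj.
Qed.

Lemma linmapE (D : diagram G) i j i' j' k (f : CKh D i j) (v : generator D i' j') :
  linmap D i j i' j' k f v = \sum_u f u * k (val u) (val v).
Proof.
rewrite /linmap linfunE ?ffunE // => c g h; apply/ffunP=> x; rewrite !ffunE scaler_sumr.
by rewrite -big_split; apply: eq_bigr => u _; rewrite !ffunE mulrDl -scalerAl.
Qed.

(** The operator whose kernel is [homCKh] is linear over the cyclotomic field because multiplication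
    by [xi d] commutes with the scalars acting on the source. *)
Lemma homCKhP (D : diagram G) d i j (f : 'Hom(Qxi d, CKh D i j)) :
  reflect (forall x, rotCKh D i j (f x) = f (xi d * x)) (f \in homCKh D d i j).
Proof.
pose F (g : cycHom (Qxi d) (CKh D i j)) : cycHom (Qxi d) (CKh D i j) :=
  (rotCKh D i j \o g)%VF - (g \o amull (xi d))%VF.
have FE g x : (F g : 'Hom(_, _)) x
    = rotCKh D i j ((g : 'Hom(_, _)) x) - (g : 'Hom(_, _)) (xi d * x).
  by rewrite [LHS]add_lfunE opp_lfunE !comp_lfunE lfunE.
have evD c (g h : cycHom (Qxi d) (CKh D i j)) x :
    (c *: g + h : 'Hom(_, _)) x = (g : 'Hom(_, _)) (c * x) + (h : 'Hom(_, _)) x.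
  by rewrite [LHS]add_lfunE [X in X + _](cyc_scaleE c g).
have linF : linear F.
  move=> c g h; apply/lfunP=> x; rewrite evD !FE !evD linearD [xi d * (c * x)]mulrCA.
  by rewrite opprD addrACA.
have -> : (f \in homCKh D d i j) = (F f == 0).
  by rewrite -[F f](linfunE linF); exact: memv_ker.
apply: (iffP eqP) => [e x | e].
  by apply/eqP; rewrite -subr_eq0 -FE e zero_lfunE.
by apply/lfunP=> x; rewrite FE e subrr zero_lfunE.
Qed.

Section Periodic.
Variables (D : diagram G) (N : nat).
Hypotheses (per : periodic D N).

Lemma rot_site_expn : (rot_site G ^+ N = 1)%g.
Proof.
apply/permP=> c; apply/eqP; rewrite perm1 porbit_dvdn.
by rewrite (periodic_site per).
Qed.

Lemma rot_labelled_expn : (rot_labelled ^+ N = 1)%g.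
Proof.
apply/permP=> u; rewrite perm1 rot_labelledX rot_site_expn [RHS]surjective_pairing.
have it a : iter N (@rot_strand G) a = a.
  rewrite iter_rot_strand rot_site_expn; case: a => [[c b]|m]; first by rewrite perm1.
  by congr inr; apply/eqP; rewrite porbit_dvdn (periodic_mark per).
congr (_, _); rewrite -[RHS]imset_id; apply: eq_imset => x; first by rewrite perm1.
by rewrite -[RHS]imset_id; apply: eq_imset => a; rewrite it.
Qed.

Lemma circles_rot (S : {set site G}) :
  circles D (rot_site G @: S) = [set (@rot_strand G) @: (C : {set strand G}) | C in circles D S].
Proof.
apply: classes_bij rot_strand_inj _ => a b.
rewrite /smoothing_adjacent !(periodic_next per) !opposite_rot.
by rewrite !(inj_eq rot_strand_inj) !(horizontal_rot _ _ (periodic_kind per)).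
Qed.

Lemma crossings_rot : rot_site G @: crossings D = crossings D.
Proof.
apply/setP=> c; rewrite -[c](permKV (rot_site G)) mem_imset; last exact: perm_inj.
by rewrite !inE (periodic_kind per).
Qed.

Lemma is_generator_rot u : is_generator D (rot_labelled u) = is_generator D u.
Proof.
rewrite permE /is_generator /= circles_rot -{1}crossings_rot.
have sub (T : finType) (f : T -> T) (A B : {set T}) :
    injective f -> (f @: A \subset f @: B) = (A \subset B).
  move=> f_inj; apply/idP/idP => [/subsetP AB | ]; last exact: imsetS.
  by apply/subsetP=> x xA; have := AB (f x); rewrite !mem_imset //; apply.
rewrite sub; last exact: perm_inj.
by rewrite sub //; exact/imset_inj/rot_strand_inj.
Qed.

Lemma bidegree_rot u : bidegree D (rot_labelled u) = bidegree D u.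
Proof.
have c1 : #|rot_site G @: u.1| = #|u.1| by rewrite card_imset //; exact: perm_inj.
have f_inj := imset_inj rot_strand_inj.
rewrite permE /bidegree /label_degree /= c1 circles_rot !cardsD -imsetI; last first.
  by move=> ? ? _ _; exact: f_inj.
by rewrite !(card_imset _ f_inj).
Qed.

(** The dimension counts the orbits of generators around which the product of the factors [rot_sign]
    and [(xi d)^-1] is 1; for odd [N] this only asks that [d] divide the length. The count is then
    spread over the generators as in [sum_porbit_repr]. *)
Lemma dim_homCKh (F : fieldType) d i j :
    [pchar F] =i pred0 -> odd N -> (0 < d)%N -> (d %| N)%N ->
  (\dim (homCKh D d i j))%:R
    = \sum_(u | is_generator D u && (bidegree D u == (i, j))
                 && (d %| #|porbit rot_labelled u|)%N) (#|porbit rot_labelled u|%:R)^-1 :> F.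
Proof.
move=> F0 odd_N d_gt0 dN; have N_gt0 := odd_gt0 odd_N.
pose P u := is_generator D u && (bidegree D u == (i, j)).
have rotP u : P (rot_labelled u) = P u by rewrite /P is_generator_rot bidegree_rot.
pose s := sub_perm rotP; pose sg (v : {u | P u}) := rot_sign (val v).1.
pose w v := sg v *: (xi d)^-1.
have cw k v : cocycle s w k v = cocycle s sg k v *: (xi d)^-1 ^+ k.
  elim: k => [|k IH]; first by rewrite !cocycle0 scale1r.
  by rewrite !cocycleSr IH -scalerAl -scalerAr scalerA exprSr.
have csg v : cocycle s sg N v = 1.
  rewrite -[RHS](prod_rot_sign (val v).1 rot_site_expn).
  by apply: eq_bigr => k _; rewrite /sg val_sub_permX rot_labelledX.
have xiN : (xi d)^-1 ^+ N = 1 by rewrite exprVn (eqP (_ : xi d ^+ N == 1)) ?invr1 // xi_exp_eq1.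
have nz_xi : xi d != 0.
  apply/eqP=> xi0; have := xi_exp_eq1 N d_gt0.
  by rewrite xi0 expr0n gtn_eqF // eq_sym oner_eq0 dN.
have cm v : (cocycle s w #|porbit s v| v == 1) = (d %| #|porbit s v|)%N.
  rewrite cw; set m := #|porbit s v|; set e := cocycle s sg m v.
  have m_dvd : (m %| N)%N.
    by rewrite -porbit_dvdn -val_eqE val_sub_permX rot_labelled_expn perm1.
  have e2 : e ^+ 2 = 1 by rewrite -prodrXl big1 // => k _; exact: rot_sign_sqr.
  (* The sign [e] satisfies [e ^+ (N %/ m) = 1] with an odd exponent, while [e ^+ 2 = 1]. *)
  have -> : e = 1.
    have := csg v; rewrite -(divnK m_dvd) cocycle_muln -/e.
    have : odd (N %/ m) by move: odd_N; rewrite -{1}(divnK m_dvd) oddM => /andP[].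
    rewrite -[in e ^+ _](odd_double_half (N %/ m)) => ->.
    by rewrite exprD -mul2n exprM e2 expr1n mulr1.
  by rewrite scale1r exprVn invr_eq1 xi_exp_eq1.
have dim_H : \dim (homCKh D d i j) =
    #|[pred v | (d %| #|porbit s v|)%N && (porbit_repr s v == v)]|.
  transitivity #|[pred v | (cocycle s w #|porbit s v| v == 1) && (porbit_repr s v == v)]|.
    apply: (dim_cycHom_equivariant (N := N) (T := rotCKh D i j)) nz_xi _ _ => //.
    - by apply/permP=> v; apply/val_inj; rewrite val_sub_permX rot_labelled_expn !perm1.
    - by move=> v; rewrite cw csg scale1r.
    - move=> f v; rewrite linmapE (bigD1 v) //= big1 ?addr0 => [|u ne_uv].
        by rewrite /rot_coef val_sub_perm permE /= !eqxx mulrC.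
      rewrite /rot_coef ifN ?mulr0 // val_sub_perm -xpair_eqE -surjective_pairing.
      have <- : rot_labelled (val u) = (rot_site G @: (val u).1,
          [set (@rot_strand G) @: (C : {set strand G}) | C in (val u).2]) by rewrite permE.
      by rewrite (inj_eq perm_inj) val_eqE eq_sym.
    - exact: homCKhP.
  by apply: eq_card => v; rewrite !inE cm.
rewrite dim_H -sum1_card natr_sum.
transitivity (\sum_(v : {u | P u} | (d %| #|porbit s v|)%N) (1 / #|porbit s v|%:R) : F).
  symmetry; apply: (@sum_porbit_repr _ s F _ (fun=> 1)) => // v.
  by have := porbit_perm s 1 v; rewrite expg1 => ->.
rewrite [RHS](eq_bigl (fun u => P u && (d %| #|porbit rot_labelled u|)%N)) //.
rewrite [RHS](reindex_omap (val : {u | P u} -> labelled G) insub) => [|u /andP[Pu _]];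
  last by rewrite insubT.
by apply: eq_big => [v | v _]; rewrite card_porbit_sub_perm ?div1r // valK eqxx (valP v) andbT.
Qed.

End Periodic.
End Rotation.

(** * Jones polynomials as sums over orbits *)

Lemma pchar_Zq : [pchar Zq] =i pred0.
Proof.
apply/pcharf0P=> n; rewrite -(rmorph_nat (@tofrac {poly int})) tofrac_eq0.
by rewrite -polyC_natr polyC_eq0 pnatr_eq0.
Qed.

Lemma q_neq0 : q != 0.
Proof. by rewrite tofrac_eq0 polyX_eq0. Qed.

Lemma sum_subseq_support (I : eqType) (V : nmodType) (r r' : seq I) (f : I -> V) :
    uniq r -> uniq r' -> {subset r <= r'} -> {in r', forall x, x \notin r -> f x = 0} ->
  \sum_(x <- r') f x = \sum_(x <- r) f x.
Proof.
move=> r_uniq r'_uniq sub f0.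
rewrite -(@big_rmcond_in _ _ _ _ r' [in r]) // -big_filter; apply: perm_big.
apply: uniq_perm; rewrite ?filter_uniq // => x; rewrite mem_filter.
by apply: andb_idr; exact: sub.
Qed.

Section Jones.
Variables (G : shadow) (D : diagram G) (d : nat).

(** Rank-nullity for the differential restricted to [homCKh], whose kernel there is the space of
    cocycles. *)
Lemma dim_coboundaries i j :
  (\dim (coboundaries D d (i + 1) j))%:Z
    = (\dim (homCKh D d i j))%:Z - (\dim (cocycles D d i j))%:Z.
Proof.
(* The coboundaries at [i + 1] come from [i + 1 - 1], which is only provably equal to [i]; the index
   is generalised because the types depend on it. *)
have e i' : i' = i -> (\dim (diff_homCKh D d i' (i + 1) j @: homCKh D d i' j))%:Z
    = (\dim (homCKh D d i j))%:Z - (\dim (cocycles D d i j))%:Z.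
  by move=> ->; rewrite /cocycles capvC -(limg_ker_dim (diff_homCKh D d i (i + 1) j)
      (homCKh D d i j)) PoszD addrAC subrr add0r.
by apply: e; rewrite addrK.
Qed.

Lemma dim_cycHom_eq0 i j (V : {vspace cycHom (Qxi d) (CKh D i j)}) :
  (i, j) \notin bidegrees D -> \dim V = 0%N.
Proof.
move=> out; apply/eqP; rewrite -leqn0; apply: leq_trans (dimvS (subvf V)) _.
rewrite dimvf; change (\dim {: CKh D i j} <= 0)%N; rewrite dimvf.
change (#|{: generator D i j}| * 1 <= 0)%N; rewrite muln1 leqn0; apply/eqP/eq_card0 => u.
apply/negP=> _; case/negP: out; have /andP[gen_u /eqP <-] := valP u.
by rewrite mem_undup; apply: map_f; rewrite mem_enum.
Qed.

Lemma dimKhE i j : dimKh D d (i + 1) j =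
  (\dim (cocycles D d (i + 1) j))%:Z + (\dim (cocycles D d i j))%:Z - (\dim (homCKh D d i j))%:Z.
Proof. by rewrite /dimKh dim_coboundaries opprB addrA. Qed.

(* The ranks of the differentials cancel in the alternating sum. *)
Lemma J_homCKh :
  J d D = \sum_(ij <- bidegrees D) (-1) ^ ij.1 * q ^ ij.2 * (\dim (homCKh D d ij.1 ij.2))%:R.
Proof.
(* Coboundaries out of the support [B] are accounted for one degree higher, so the sum is taken over
   the union [B'] of [B] and its shift. *)
pose B := bidegrees D; pose sh (ij : int * int) := (ij.1 + 1, ij.2).
have sh_inj : injective sh by move=> [a b] [c e] [/addIr-> ->].
pose B' := undup (B ++ map sh B).
pose g (ij : int * int) : Zq := (-1) ^ ij.1 * q ^ ij.2.
pose z (ij : int * int) : Zq := (\dim (cocycles D d ij.1 ij.2))%:R.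
pose h (ij : int * int) : Zq := (\dim (homCKh D d ij.1 ij.2))%:R.
pose pre (ij : int * int) := (ij.1 - 1, ij.2).
have out ij : ij \notin B -> z ij = 0 /\ h ij = 0.
  by case: ij => i j nB; rewrite /z /h !dim_cycHom_eq0.
have dimE ij : (dimKh D d ij.1 ij.2)%:~R = z ij + (z (pre ij) - h (pre ij)) :> Zq.
  rewrite -{1}[ij.1](subrK 1) dimKhE /= subrK -addrA.
  by rewrite rmorphD rmorphB.
have B_uniq : uniq B by exact: undup_uniq.
have B'_uniq : uniq B' by exact: undup_uniq.
have sub1 : {subset B <= B'} by move=> x; rewrite [x \in B']mem_undup mem_cat => ->.
have sub2 : {subset map sh B <= B'} by move=> x; rewrite [x \in B']mem_undup mem_cat orbC => ->.
transitivity (\sum_(ij <- B') (g ij * z ij + g ij * (z (pre ij) - h (pre ij)))).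
  rewrite [RHS](sum_subseq_support B_uniq) //.
    by apply: eq_bigr => ij _; rewrite dimE mulrDr.
  move=> [i j] _ nB; rewrite -mulrDr -dimE /= /dimKh /cocycles !dim_cycHom_eq0 //.
  by rewrite subrr mulr0.
rewrite big_split /= (sum_subseq_support B_uniq B'_uniq sub1); last first.
  by move=> ij _ /out[-> _]; rewrite mulr0.
rewrite (sum_subseq_support _ B'_uniq sub2) ?map_inj_uniq //; last first.
  move=> ij _ nB; have /out[-> ->] : pre ij \notin B.
    apply: contra nB => ?; apply/mapP; exists (pre ij) => //.
    by case: (ij) => a b; rewrite /sh /= subrK.
  by rewrite subrr mulr0.
(* Shifting [i] by one flips the sign: the cocycle terms cancel and the dimension of [homCKh]
   remains. *)
rewrite big_map -big_split /=; apply: eq_bigr => -[i j] _.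
rewrite /g /pre /sh /= addrK -/(z (i, j)) -/(h (i, j)).
rewrite expfzDr ?oppr_eq0 ?oner_eq0 // expr1z mulrN1 !mulNr mulrBr opprB.
by rewrite addrC subrK.
Qed.

Definition weight (u : labelled G) : Zq :=
  (-1) ^ (bidegree D u).1 * q ^ (bidegree D u).2.

Lemma J_orbits N :
    periodic D N -> odd N -> (0 < d)%N -> (d %| N)%N ->
  J d D = \sum_(u | is_generator D u && (d %| #|porbit (rot_labelled G) u|)%N)
            weight u / #|porbit (rot_labelled G) u|%:R.
Proof.
move=> per odd_N d_gt0 dN; rewrite J_homCKh; pose m u := #|porbit (rot_labelled G) u|.
transitivity (\sum_(ij <- bidegrees D) \sum_(u | is_generator D u && (d %| m u)%N)
    if bidegree D u == ij then weight u / (m u)%:R else 0).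
  apply: eq_bigr => -[i j] _; rewrite (dim_homCKh per i j pchar_Zq) // mulr_sumr.
  rewrite -big_mkcondr; apply: eq_big => u; first by rewrite andbAC.
  by rewrite -andbA => /and3P[_ /eqP e _]; rewrite /weight e.
rewrite exchange_big /=; apply: eq_bigr => u /andP[gen_u _].
rewrite -big_mkcond (big_rem (bidegree D u)) /= ?eqxx; last first.
  by rewrite mem_undup map_f // mem_enum.
rewrite big_seq_cond big1 ?addr0 // => ij /andP[ij_rem /eqP e].
by move: ij_rem; rewrite -e mem_rem_uniqF ?undup_uniq.
Qed.
End Jones.

(** [A] is a union of orbits of length [k]; with all weights equal to [k^-1], [sum_porbit_repr] says
    that [#|A| / k] counts their representatives. *)
Lemma dvdn_card_porbit (X : finType) (s : {perm X}) (A : {set X}) k :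
    (forall x, (s x \in A) = (x \in A)) -> {in A, forall x, #|porbit s x| = k} ->
  (k %| #|A|)%N.
Proof.
move=> sA sk; have rat0 : [pchar rat] =i pred0 by exact: pchar_num.
have := @sum_porbit_repr _ s rat (mem A) (fun=> 1%:R) rat0 sA (fun _ => erefl).
have [->|[x xA]] := set_0Vmem A; first by rewrite cards0 dvdn0.
have nz_k : k%:R != 0 :> rat by rewrite pnatr_eq0 -(sk x xA) card_porbit_neq0.
under eq_bigr => y yA do rewrite sk //.
rewrite -mulr_suml -!natr_sum !sum1_card => /(canRL (divfK nz_k)) /eqP.
by rewrite -natrM eqr_nat => /eqP->; rewrite dvdn_mull.
Qed.

(** * Laurent polynomials *)

Lemma is_laurent_tofrac (P : {poly int}) : is_laurent (tofrac P).
Proof. by exists P, 0%N; rewrite expr0 divr1. Qed.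

Lemma is_laurentD f g : is_laurent f -> is_laurent g -> is_laurent (f + g).
Proof.
move=> [P [k ->]] [Q [l ->]]; exists (P * 'X^l + Q * 'X^k), (k + l)%N.
have nz_q j := expf_neq0 j q_neq0.
by rewrite addf_div ?nz_q // exprD rmorphD !rmorphM !rmorphXn.
Qed.

Lemma is_laurentM f g : is_laurent f -> is_laurent g -> is_laurent (f * g).
Proof.
move=> [P [k ->]] [Q [l ->]]; exists (P * Q), (k + l)%N.
by rewrite rmorphM exprD invfM mulrACA.
Qed.

Lemma is_laurentN f : is_laurent f -> is_laurent (- f).
Proof. by move=> [P [k ->]]; exists (- P), k; rewrite rmorphN mulNr. Qed.

Lemma is_laurent_sum (I : Type) (r : seq I) (P : pred I) (F : I -> Zq) :
  (forall i, P i -> is_laurent (F i)) -> is_laurent (\sum_(i <- r | P i) F i).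
Proof.
move=> PF; elim/big_ind: _ => //; last exact: is_laurentD.
by rewrite -(rmorph0 (@tofrac {poly int})); exact: is_laurent_tofrac.
Qed.

Lemma is_laurent_expq (k : int) : is_laurent (q ^ k).
Proof.
case: k => k; first by rewrite -exprnP -rmorphXn; exact: is_laurent_tofrac.
by exists 1, k.+1; rewrite rmorph1 mul1r.
Qed.

Lemma is_laurent_signz (k : int) : is_laurent ((-1) ^ k).
Proof.
suff sgn n : is_laurent ((-1) ^+ n)
  by case: k => k; [exact: sgn | rewrite NegzE -exprnN invr_sign; exact: sgn].
by rewrite -(rmorphN1 (@tofrac {poly int})) -rmorphXn; exact: is_laurent_tofrac.
Qed.

Lemma is_laurent_weight (G : shadow) (D : diagram G) u : is_laurent (weight D u).
Proof. exact: is_laurentM (is_laurent_signz _) (is_laurent_expq _). Qed.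

(** With [x = q ^+ k], the left side is [x^(-2j) (1 - x^(2(j-i)))]; a geometric sum extracts
    [x^2 - 1 = x (x - x^-1)]. *)
Lemma dvd_expq_sub k i j : (i <= j)%N ->
  exists2 a, is_laurent a &
    q ^- (2 * (k * j)) - q ^- (2 * (k * i)) = a * (q ^+ k - q ^- k).
Proof.
move=> le_ij; set x := q ^+ k; have nz_x : x != 0 by rewrite expf_neq0 ?q_neq0.
exists (- (q ^- (2 * (k * j)) * (x * \sum_(l < j - i) (x ^+ 2) ^+ l))).
  apply/is_laurentN/is_laurentM; first by rewrite exprnN; exact: is_laurent_expq.
  apply/is_laurentM; first exact: (is_laurent_expq k).
  by apply: is_laurent_sum => l _; rewrite -!exprM; exact: (is_laurent_expq (k * (2 * l))%N).
rewrite mulNr -!mulrA [_ * (x - _)]mulrC; set S := \sum_(l < _) _.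
have -> : x * ((x - x^-1) * S) = (x ^+ 2) ^+ (j - i) - 1.
  by rewrite subrX1 mulrA; congr (_ * _); rewrite mulrBr divff.
rewrite mulrBr mulr1 opprB; congr (_ - _).
have -> : q ^+ (2 * (k * j)) = q ^+ (2 * (k * i)) * (x ^+ 2) ^+ (j - i).
  by rewrite -!exprM -exprD; congr (q ^+ _); rewrite mulnCA (mulnCA 2) -mulnDr -mulnDr subnKC.
have nz : (x ^+ 2) ^+ (j - i) != 0 by do 2!apply: expf_neq0.
by rewrite invfM (divfK nz).
Qed.

(** * Difference Jones polynomials as sums over orbits of a fixed length *)

Section DifferenceJones.
Variables (p n : nat) (G : shadow) (D : diagram G).
Hypotheses (p_prime : prime p) (p_odd : odd p) (per : periodic D (p ^ n)).

(** Orbit lengths are powers of [p], so those divisible by [p ^ s] but not by [p ^ s.+1] equal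
    [p ^ s]. *)
Lemma DJ_orbits s : (s <= n)%N ->
  DJ p n s D = \sum_(u | is_generator D u && (#|porbit (rot_labelled G) u| == p ^ s)%N)
                 weight D u / (p ^ s)%:R.
Proof.
move=> le_sn; have odd_N : odd (p ^ n) by rewrite oddX p_odd orbT.
have p_gt1 := prime_gt1 p_prime; have p_gt0 k : (0 < p ^ k)%N by rewrite expn_gt0 prime_gt0.
pose m u := #|porbit (rot_labelled G) u|; pose W u := weight D u / (m u)%:R.
have Jk k : (k <= n)%N -> J (p ^ k) D = \sum_(u | is_generator D u && (p ^ k %| m u)%N) W u.
  by move=> le_kn; apply: J_orbits per odd_N _ _; rewrite ?dvdn_exp2l.
have mP u : exists2 k, (k <= n)%N & m u = (p ^ k)%N.
  apply/dvdn_pfactor => //; rewrite /m -porbit_dvdn.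
  by rewrite (rot_labelled_expn per) perm1.
(* For [s = n] no orbit length is divisible by [p ^ n.+1], so the convention fits the general
   formula. *)
have last_J : (if s == n then 0 else J (p ^ s.+1) D)
    = \sum_(u | is_generator D u && (p ^ s.+1 %| m u)%N) W u.
  case: eqVneq => [-> | ne_sn]; last by rewrite Jk // ltn_neqAle ne_sn.
  rewrite big_pred0 // => u; have [k le_kn ->] := mP u.
  by rewrite dvdn_Pexp2l // ltnNge le_kn andbF.
rewrite /DJ last_J Jk // (bigID (fun u => p ^ s.+1 %| m u)%N) /=.
have -> : \sum_(u | is_generator D u && (p ^ s %| m u)%N && (p ^ s.+1 %| m u)%N) W u
    = \sum_(u | is_generator D u && (p ^ s.+1 %| m u)%N) W u.
  apply: eq_bigl => u; rewrite -andbA; congr (_ && _); have [k _ ->] := mP u.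
  by rewrite !dvdn_Pexp2l //; case: (ltnP s k) => [/ltnW->|]; rewrite ?andbF.
rewrite addrC addrK (eq_bigl (fun u => is_generator D u && (m u == p ^ s)%N)) => [|u].
  by apply: eq_bigr => u /andP[_ /eqP <-].
rewrite -andbA; congr (_ && _); have [k _ ->] := mP u.
by rewrite !dvdn_Pexp2l // eqn_exp2l // -leqNgt -eqn_leq eq_sym.
Qed.
End DifferenceJones.

(** * The skein relation *)

(** Crossing signs and states enter the circles only through [horizontal]. *)
Lemma eq_circles (G : shadow) (D D' : diagram G) (S S' : {set site G}) :
  horizontal D S =1 horizontal D' S' -> circles D S = circles D' S'.
Proof.
move=> hh; apply: eq_imset => x; apply/setP=> y; rewrite !inE.
by apply: eq_connect => a b; rewrite /smoothing_adjacent !hh.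
Qed.

Section Skein.
Variables (p n : nat) (G : shadow) (Dp Dm D0 : diagram G) (c0 : site G).
Hypotheses (p_prime : prime p) (p_odd : odd p).
Hypotheses (per_Dp : periodic Dp (p ^ n)) (per_Dm : periodic Dm (p ^ n))
  (per_D0 : periodic D0 (p ^ n)).
Local Notation orb := (porbit (rot_site G) c0).
Hypotheses (Dp_orbit : forall c, c \in orb -> Dp c = Positive)
  (Dm_orbit : forall c, c \in orb -> Dm c = Negative)
  (D0_orbit : forall c, c \in orb -> D0 c = Smoothed)
  (same_elsewhere : forall c, c \notin orb -> Dm c = Dp c /\ D0 c = Dp c).
Local Notation N := (p ^ n)%N.
Local Notation m u := #|porbit (rot_labelled G) u|.

Lemma orb_rot c : (rot_site G c \in orb) = (c \in orb).
Proof. by rewrite -!eq_porbit_mem; have := porbit_perm (rot_site G) 1 c; rewrite expg1 => ->. Qed.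

(** A positive and a negative crossing exchange their 0- and 1-smoothings, so the resolved picture
    is the same and the labelled circles are kept. *)
Definition toggle (u : labelled G) : labelled G :=
  ([set c | (c \in u.1) (+) (c \in orb)], u.2).

Lemma toggleK : involutive toggle.
Proof.
move=> [S P]; congr (_, _); apply/setP=> c.
by rewrite !inE /= -addbA addbb addbF.
Qed.

Lemma toggle_rot u : toggle (rot_labelled G u) = rot_labelled G (toggle u).
Proof.
rewrite !permE; congr (_, _); apply/setP=> c; rewrite -[c](permKV (rot_site G)).
rewrite !inE orb_rot !mem_imset; try exact: perm_inj.
by rewrite !inE.
Qed.

Lemma card_porbit_toggle u : m (toggle u) = m u.
Proof. exact: card_porbit_equivariant (inv_inj toggleK) toggle_rot. Qed.

Lemma circles_toggle u : circles Dm (toggle u).1 = circles Dp u.1.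
Proof.
apply: eq_circles => -[[c b]|//] /=; rewrite inE.
have [c_orb | c_out] := boolP (c \in orb).
  by rewrite Dp_orbit // Dm_orbit // addbT negbK.
by rewrite (same_elsewhere c_out).1 addbF.
Qed.

(** The 0-smoothing of a positive crossing is its oriented resolution. *)
Lemma circles_disjoint (S : {set site G}) :
  S :&: orb = set0 -> circles D0 S = circles Dp S.
Proof.
move=> S_out; apply: eq_circles => -[[c b]|//] /=.
have [c_orb | c_out] := boolP (c \in orb); last by rewrite (same_elsewhere c_out).2.
rewrite Dp_orbit // D0_orbit //; move/setP/(_ c): S_out.
by rewrite !inE c_orb andbT.
Qed.

Lemma crossings_Dm : crossings Dm = crossings Dp.
Proof.
apply/setP=> c; rewrite !inE; have [c_orb | c_out] := boolP (c \in orb).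
  by rewrite Dp_orbit // Dm_orbit.
by rewrite (same_elsewhere c_out).1.
Qed.

Lemma mem_crossings_D0 c : (c \in crossings D0) = (c \notin orb) && (c \in crossings Dp).
Proof.
rewrite !inE; have [c_orb | c_out] := boolP (c \in orb); first by rewrite D0_orbit.
by rewrite (same_elsewhere c_out).2.
Qed.

Lemma is_generator_toggle u : is_generator Dm (toggle u) = is_generator Dp u.
Proof.
rewrite /is_generator circles_toggle crossings_Dm; congr (_ && _).
apply/subsetP/subsetP=> sub c; have := sub c; rewrite !inE /=.
all: by case: (boolP (c \in orb)) => [/Dp_orbit-> | _]; rewrite ?addbF /=.
Qed.

Lemma is_generator_D0 u : is_generator D0 u = is_generator Dp u && (u.1 :&: orb == set0).
Proof.
rewrite /is_generator andbAC.
have [out | meet] := eqVneq (u.1 :&: orb) set0; last first.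
  rewrite andbF; apply/negP=> /andP[/subsetP sub _].
  have /set0Pn[c] := meet; rewrite !inE => /andP[/sub].
  by rewrite mem_crossings_D0 => /andP[/negPf->].
rewrite andbT circles_disjoint //; congr (_ && _).
apply/subsetP/subsetP=> sub c cu; have := sub c cu; rewrite mem_crossings_D0.
  by case/andP.
by move=> ->; rewrite andbT; move/setP/(_ c): out; rewrite !inE cu /= => ->.
Qed.

Lemma card_orb : #|orb| = N.
Proof. exact: periodic_site per_Dp c0. Qed.

Lemma card_orb_add (A B : {set site G}) :
    {in orb, forall c, (c \in A) /\ (c \notin B)} ->
    (forall c, c \notin orb -> (c \in A) = (c \in B)) ->
  #|A| = (#|B| + N)%N.
Proof.
move=> inO outO; rewrite -(cardsID orb A) addnC; congr (_ + _)%N.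
  by apply: eq_card => c; rewrite !inE; case: (boolP (c \in orb)) => [/inO[_ /negPf->] | /outO->].
rewrite -card_orb; apply: eq_card => c; rewrite !inE.
by case: (boolP (c \in orb)) => [/inO[->] | _]; rewrite ?andbF.
Qed.

Lemma npos_Dp : npos Dp = (npos D0 + N)%N.
Proof.
apply: card_orb_add => [c c_orb | c c_out]; rewrite !inE.
  by rewrite Dp_orbit // D0_orbit.
by rewrite (same_elsewhere c_out).2.
Qed.

Lemma npos_Dm : npos Dm = npos D0.
Proof.
apply: eq_card => c; rewrite !inE.
have [c_orb | c_out] := boolP (c \in orb); first by rewrite Dm_orbit // D0_orbit.
by have [-> ->] := same_elsewhere c_out.
Qed.

Lemma nneg_Dm : nneg Dm = (nneg D0 + N)%N.
Proof.
apply: card_orb_add => [c c_orb | c c_out]; rewrite !inE.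
  by rewrite Dm_orbit // D0_orbit.
by have [-> ->] := same_elsewhere c_out.
Qed.

Lemma nneg_Dp : nneg Dp = nneg D0.
Proof.
apply: eq_card => c; rewrite !inE.
have [c_orb | c_out] := boolP (c \in orb); first by rewrite Dp_orbit // D0_orbit.
by rewrite (same_elsewhere c_out).2.
Qed.

(** With [t] the size of the intersection, [t] crossings leave and [N - t] enter; the form avoids
    truncated subtraction. *)
Lemma card_toggle (u : labelled G) :
  (#|(toggle u).1| + 2 * #|u.1 :&: orb| = #|u.1| + N)%N.
Proof.
have -> : (toggle u).1 = (u.1 :\: orb) :|: (orb :\: u.1).
  by apply/setP=> c; rewrite !inE; do 2!case: (c \in _).
rewrite cardsU (_ : _ :&: _ = set0) ?cards0 ?subn0; last first.
  by apply/setP=> c; rewrite !inE; do 2!case: (c \in _).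
rewrite -card_orb -(cardsID orb u.1) -(cardsID u.1 orb) (setIC orb) mul2n -addnn.
by rewrite [RHS]addnACA addnC.
Qed.

Lemma weight_D0 u : u.1 :&: orb = set0 -> weight Dp u = weight D0 u * q ^+ N.
Proof.
move=> out; rewrite /weight /bidegree /label_degree /= npos_Dp nneg_Dp circles_disjoint //.
rewrite exprnP -[RHS]mulrA -expfzDr ?q_neq0 //; congr (_ * q ^ _).
by rewrite PoszD; lia.
Qed.

(** The homological degrees differ by twice the size of the intersection, so the signs agree and
    only the power of [q] changes. *)
Lemma weight_toggle u :
  q ^+ (2 * N) * weight Dm (toggle u) = weight Dp u * q ^- (2 * #|u.1 :&: orb|).
Proof.
have card_t := card_toggle u; set t := #|_ :&: _| in card_t *.
rewrite /weight /bidegree /label_degree circles_toggle npos_Dm nneg_Dm npos_Dp nneg_Dp /=.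
rewrite /= in card_t *; set T := #|finset _| in card_t *.
rewrite exprnN exprnP mulrCA -expfzDr ?q_neq0 //.
rewrite -[RHS]mulrA -expfzDr ?q_neq0 //; congr (_ * q ^ _); last by lia.
have -> : #|u.1|%:Z - (nneg D0)%:Z
    = T%:Z - (nneg D0 + N)%N%:Z + 2 * t%:Z.
  by clearbody t T; move: (p ^ n)%N (nneg D0) #|u.1| card_t => x y z; lia.
rewrite [RHS]expfzDr ?oppr_eq0 ?oner_eq0 // -exprz_exp (_ : (-1) ^ 2 = 1) ?exp1rz ?mulr1 //.
by rewrite -exprnP sqrrN expr1n.
Qed.

(** Everything is indexed by the generators of [Dp]: those of [Dm] through [toggle], those of [D0]
    as the ones that avoid the orbit. On the latter the three terms cancel. *)
Lemma skein_defect M :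
  let part D := \sum_(u | is_generator D u && (m u == M)) weight D u / M%:R in
  q ^- (2 * N) * part Dp - q ^+ (2 * N) * part Dm - (q ^- N - q ^+ N) * part D0
    = \sum_(u | is_generator Dp u && (m u == M))
        (if u.1 :&: orb == set0 then 0
         else weight Dp u * (q ^- (2 * N) - q ^- (2 * #|u.1 :&: orb|))) / M%:R.
Proof.
rewrite /=; rewrite !mulr_sumr.
rewrite [X in _ - X - _](reindex_inj (inv_inj toggleK)) /=.
under [X in _ - X - _]eq_bigl => u do rewrite is_generator_toggle card_porbit_toggle.
under [X in _ - _ - X]eq_bigl => u do rewrite is_generator_D0 andbAC.
rewrite [X in _ - _ - X]big_mkcondr -!sumrB; apply: eq_bigr => u _ /=.
rewrite ![_ * (_ / _)]mulrA weight_toggle [q ^- _ * _]mulrC -mulrBl -mulrBr.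
case: eqP => [out | _]; last by rewrite subr0.
rewrite mul0r mulrA -mulrBl (weight_D0 out) out cards0 muln0 expr0 invr1.
have nz_qN : q ^+ N != 0 by rewrite expf_neq0 ?q_neq0.
rewrite mulnC exprM; move: (q ^+ N) nz_qN => x nz_x.
have -> : weight D0 u * x * (x ^- 2 - 1) = (x^-1 - x) * weight D0 u.
  by rewrite [RHS]mulrC -mulrA mulrBr mulr1 expr2 invfM mulVKf.
by rewrite /weight !mulrA subrr mul0r.
Qed.

(** The rotation to the power [p ^ (n - s)] fixes [u], hence preserves the intersection, and moves
    the crossings in orbits of length [p ^ s]. *)
Lemma dvdn_card_cap_orb s u : (s <= n)%N -> m u = (p ^ (n - s))%N -> (p ^ s %| #|u.1 :&: orb|)%N.
Proof.
move=> le_sn mu; have p_gt0 k : (0 < p ^ k)%N by rewrite expn_gt0 prime_gt0.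
have N_E : N = (p ^ (n - s) * p ^ s)%N by rewrite -expnD subnK.
have fix_u : [set (rot_site G ^+ (p ^ (n - s)))%g c | c in u.1] = u.1.
  have /eqP : ((rot_labelled G ^+ (p ^ (n - s)))%g u == u) by rewrite porbit_dvdn mu.
  by rewrite rot_labelledX => /(congr1 fst).
have orbX k c : ((rot_site G ^+ k)%g c \in orb) = (c \in orb).
  by rewrite -!eq_porbit_mem porbit_perm.
apply: (@dvdn_card_porbit _ (rot_site G ^+ (p ^ (n - s)))%g) => [c | c _].
  by rewrite !inE orbX -{1}fix_u mem_imset //; exact: perm_inj.
have e j : (#|porbit (rot_site G ^+ (p ^ (n - s)))%g c| %| j)%N = (p ^ s %| j)%N.
  by rewrite -porbit_dvdn -expgM porbit_dvdn (periodic_site per_Dp) N_E dvdn_pmul2l.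
by apply/eqP; rewrite eqn_dvd e dvdnn -e dvdnn.
Qed.

Let defect u : Zq := if u.1 :&: orb == set0 then 0
  else weight Dp u * (q ^- (2 * N) - q ^- (2 * #|u.1 :&: orb|)).

Lemma DJ_defect s : (s <= n)%N ->
  q ^- (2 * N) * DJ p n s Dp - q ^+ (2 * N) * DJ p n s Dm - (q ^- N - q ^+ N) * DJ p n s D0
    = \sum_(u | is_generator Dp u && (m u == p ^ s)%N) defect u / (p ^ s)%:R.
Proof.
move=> le_sn; rewrite !DJ_orbits //.
exact: (skein_defect (p ^ s)%N).
Qed.

Lemma skein_DJ0 :
  q ^- (2 * N) * DJ p n 0 Dp - q ^+ (2 * N) * DJ p n 0 Dm = (q ^- N - q ^+ N) * DJ p n 0 D0.
Proof.
apply/eqP; rewrite -subr_eq0 DJ_defect //; apply/eqP/big1 => u /andP[_ /eqP mu].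
rewrite /defect; case: eqVneq => [_ | meet]; first by rewrite mul0r.
(* A nonempty subset of the distinguished orbit with size divisible by [N] is the whole orbit. *)
have dvd_N : (N %| #|u.1 :&: orb|)%N by apply: (dvdn_card_cap_orb (leqnn n)); rewrite subnn.
have -> : #|u.1 :&: orb| = N.
  apply/eqP; rewrite eqn_leq (dvdn_leq _ dvd_N) ?card_gt0 // andbT.
  by rewrite -card_orb subset_leq_card ?subsetIr.
by rewrite subrr mulr0 mul0r.
Qed.

Lemma skein_DJ_mod s : (s <= n)%N ->
  laurent_eqmod
    (q ^- (2 * N) * DJ p n (n - s) Dp - q ^+ (2 * N) * DJ p n (n - s) Dm)
    ((q ^- N - q ^+ N) * DJ p n (n - s) D0)
    (q ^+ (p ^ s) - q ^- (p ^ s)).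
Proof.
move=> le_sn; set h := _ - q ^- (p ^ s); set M := (p ^ (n - s))%N.
have N_E : N = (p ^ s * M)%N by rewrite -expnD subnKC.
have defect_dvd u : m u = M -> exists2 a, is_laurent a & defect u = a * h.
  move=> mu; rewrite /defect; case: eqP => _.
    exists 0; last by rewrite mul0r.
    by rewrite -(rmorph0 (@tofrac {poly int})); exact: is_laurent_tofrac.
  have /dvdnP[k t_E] := dvdn_card_cap_orb le_sn mu; rewrite mulnC in t_E.
  have le_kM : (k <= M)%N.
    rewrite -(leq_pmul2l (_ : 0 < p ^ s)%N) ?expn_gt0 ?prime_gt0 // -t_E -N_E.
    by rewrite -card_orb subset_leq_card ?subsetIr.
  have [a a_laurent e] := dvd_expq_sub (p ^ s) le_kM.
  exists (weight Dp u * a); first exact: is_laurentM (is_laurent_weight _ _) a_laurent.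
  by rewrite t_E N_E e mulrA.
suff [a la e] : exists2 a, is_laurent a &
    \sum_(u | is_generator Dp u && (m u == M)) defect u / M%:R = a * h.
  by exists a; rewrite ?DJ_defect ?leq_subr.
(* Division by [M] leaves the integral Laurent polynomials. As [defect] is constant on orbits of
   length [M], the division is absorbed by keeping one representative per orbit. *)
have defect_rot u : defect (rot_labelled G u) = defect u.
  have cap_rot : (rot_labelled G u).1 :&: orb = rot_site G @: (u.1 :&: orb).
    rewrite permE /=; apply/setP=> c; rewrite -[c](permKV (rot_site G)).
    by rewrite !inE orb_rot !mem_imset ?inE //; exact: perm_inj.
  rewrite /defect cap_rot -!cards_eq0 card_imset; last exact: perm_inj.
  by rewrite /weight (bidegree_rot per_Dp).
have gen_rot u : is_generator Dp (rot_labelled G u) && (m (rot_labelled G u) == M)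
    = is_generator Dp u && (m u == M).
  rewrite (is_generator_rot per_Dp).
  by have := porbit_perm (rot_labelled G) 1 u; rewrite expg1 => ->.
have -> : \sum_(u | is_generator Dp u && (m u == M)) defect u / M%:R
    = \sum_(u | is_generator Dp u && (m u == M) && (porbit_repr (rot_labelled G) u == u)) defect u.
  rewrite -(sum_porbit_repr pchar_Zq gen_rot defect_rot).
  by apply: eq_bigr => u /andP[_ /eqP->].
elim/big_rec: _ => [|u f /andP[/andP[_ /eqP mu] _] [b lb ->]].
  exists 0; last by rewrite mul0r.
  by rewrite -(rmorph0 (@tofrac {poly int})); exact: is_laurent_tofrac.
have [a la ->] := defect_dvd u mu.
by exists (a + b); rewrite ?mulrDl //; exact: is_laurentD.
Qed.
End Skein.

Theorem theorem3p6 (p n : nat) (G : shadow) (Dp Dm D0 : diagram G) (c0 : site G)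
  (p_prime : prime p) (p_odd : odd p) (n_gt0 : (0 < n)%N)
  (per_Dp : periodic Dp (p ^ n))
  (per_Dm : periodic Dm (p ^ n))
  (per_D0 : periodic D0 (p ^ n))
  (Dp_orbit : forall c, c \in porbit (rot_site G) c0 -> Dp c = Positive)
  (Dm_orbit : forall c, c \in porbit (rot_site G) c0 -> Dm c = Negative)
  (D0_orbit : forall c, c \in porbit (rot_site G) c0 -> D0 c = Smoothed)
  (same_elsewhere : forall c, c \notin porbit (rot_site G) c0 ->
     Dm c = Dp c /\ D0 c = Dp c) :
  q ^- (2 * p ^ n) * DJ p n 0 Dp - q ^+ (2 * p ^ n) * DJ p n 0 Dm
    = (q ^- (p ^ n) - q ^+ (p ^ n)) * DJ p n 0 D0
  /\
  forall s : nat, (s <= n)%N ->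
    laurent_eqmod
      (q ^- (2 * p ^ n) * DJ p n (n - s) Dp - q ^+ (2 * p ^ n) * DJ p n (n - s) Dm)
      ((q ^- (p ^ n) - q ^+ (p ^ n)) * DJ p n (n - s) D0)
      (q ^+ (p ^ s) - q ^- (p ^ s)).
Proof.
split=> [|s le_sn].
  exact: skein_DJ0 per_Dp per_Dm per_D0 Dp_orbit Dm_orbit D0_orbit same_elsewhere.
exact: skein_DJ_mod per_Dp per_Dm per_D0 Dp_orbit Dm_orbit D0_orbit same_elsewhere _ le_sn.
Qed.
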